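(* Fix any positive integer $k\le d$. For any $\delta>0$, with probability at least $1-\delta$ with respect to the random draws of the training set $\mathcal T^N$ of size $N$, for all $h\in\mathcal H$ the generalization error of $h$ is upper bounded as $$\Pr_{x,y}[h^Txy\le 0]\le\frac1N\sum_{n=1}^N\min\left(1,2f_k(\theta^h_{x_ny_n})\right)+\frac{2\sqrt2}{\sqrt\pi}\sqrt{\frac kN}+3\sqrt{\frac{\log(2/\delta)}{2N}}.$$
   Context: Setting: $\mathcal X\subseteq\mathbb R^d$, $\mathcal D$ is an unknown distribution on $\mathcal X\times\{-1,1\}$, and $\mathcal T^N=\{(x_n,y_n)\}_{n=1}^N$ is a training set drawn i.i.d. from $\mathcal D$; $\Pr_{x,y}$ is with respect to a fresh $(x,y)\sim\mathcal D$. $\mathcal H=\{x\mapsto\mathrm{sign}(h^Tx):h\in\mathbb R^d\}$ is the class of homogeneous linear classifiers, identified with the set of normals $h\in\mathbb R^d$. For (nonzero) $u,h\in\mathbb R^d$, $\theta_u^h$ is the angle between them. Let $R$ be a $k\times d$ random matrix with i.i.d. zero-mean Gaussian entries (used only as an analytic tool); the flipping probability is $f_k(\theta_{xy}^h):=\Pr_R((Rh)^TRxy\le 0)$, which depends only on $k$ and the angle: $f_k(\theta)=\frac{\Gamma(k)}{(\Gamma(k/2))^2}\int_0^{\frac{1-\cos\theta}{1+\cos\theta}}\frac{z^{(k-2)/2}}{(1+z)^k}\,dz$. *)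

(* Defs.v *)
From HB Require Import structures.
From mathcomp Require Import all_boot all_order all_algebra.
From mathcomp Require Import all_classical all_reals all_analysis.

Set Implicit Arguments.
Unset Strict Implicit.
Unset Printing Implicit Defensive.

Import Order.TTheory GRing.Theory Num.Theory.
Import numFieldNormedType.Exports.

Local Open Scope classical_set_scope.
Local Open Scope ring_scope.

Definition mutually_independent {dO dT : measure_display}
    {O : measurableType dO} {T : measurableType dT} {R : realType}
    {P : probability O R} {I : finType} (X : I -> {RV P >-> T}) : Prop :=
  forall (J : {set I}) (A : I -> set T), (forall i, measurable (A i)) ->
    P (\bigcap_(i in [set` J]) X i @^-1` A i) =
    (\prod_(i in J) P (X i @^-1` A i))%E.

Definition iid {dO dT : measure_display}
    {O : measurableType dO} {T : measurableType dT} {R : realType}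
    {P : probability O R} {I : finType} (X : I -> {RV P >-> T})
    (mu : set T -> \bar R) : Prop :=
  mutually_independent X /\
  forall i (A : set T), measurable A -> distribution P (X i) A = mu A.

(* [good] need not be known to be measurable (it is typically an uncountable
   intersection), hence the measurable event inside it. *)
Definition with_probability_at_least {dO : measure_display}
    {O : measurableType dO} {R : realType} (P : probability O R) (p : R)
    (good : set O) : Prop :=
  exists2 E : set O, measurable E & (p%:E <= P E)%E /\ E `<=` good.

(* Here and below, R^d x {-1, 1} is encoded as d.-tuple R * bool: tuples carry
   the product (Borel) sigma-algebra, and true (resp. false) is the label 1
   (resp. -1).
   The concentration of a distribution on X x {-1, 1}. As X is an arbitrary
   subset of R^d, this says that X x {-1, 1} has outer measure 1; for a
   measurable X it amounts to D (X x {-1, 1}) = 1. *)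
Definition supported_on {R : realType} {d : nat} (X : set (d.-tuple R))
    (D : probability (d.-tuple R * bool)%type R) : Prop :=
  forall A : set (d.-tuple R * bool), measurable A ->
    X `*` [set: bool] `<=` A -> D A = 1%E.

Definition label_val {R : realType} (b : bool) : R := if b then 1 else -1.

(* the vector x y, for z = (x, y) *)
Definition signed_point {R : realType} {d : nat} (z : d.-tuple R * bool) :
    'cV[R]_d :=
  label_val z.2 *: \col_i tnth z.1 i.

Definition dot {R : realType} {d : nat} (u v : 'cV[R]_d) : R :=
  (u^T *m v) 0 0.

(* Pr_{x,y}[h^T x y <= 0] *)
Definition generalization_error {R : realType} {d : nat}
    (D : probability (d.-tuple R * bool)%type R) (h : 'cV[R]_d) : R :=
  fine (D [set z | dot h (signed_point z) <= 0]).

(* i.i.d. zero-mean Gaussian entries, of some common standard deviation s; note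
   that the library's normal_prob is not a Gaussian law for s = 0. *)
Definition gaussian_matrix {dQ : measure_display} {Q : measurableType dQ}
    {R : realType} {PQ : probability Q R} {k d : nat}
    (G : 'I_k * 'I_d -> {RV PQ >-> R}) : Prop :=
  exists2 s : R, 0 < s & iid G (normal_prob 0 s).

Definition matrix_of {dQ : measure_display} {Q : measurableType dQ}
    {R : realType} {PQ : probability Q R} {k d : nat}
    (G : 'I_k * 'I_d -> {RV PQ >-> R}) (w : Q) : 'M[R]_(k, d) :=
  \matrix_(i, j) G (i, j) w.

(* f_k(theta_u^h) = Pr_R((R h)^T R u <= 0). For nonzero h and u this depends
   only on k and on the angle theta_u^h between them; when h or u is zero (and
   the angle is undefined) it is 1. *)
Definition flip_prob {dQ : measure_display} {Q : measurableType dQ}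
    {R : realType} {PQ : probability Q R} {k d : nat}
    (G : 'I_k * 'I_d -> {RV PQ >-> R}) (h u : 'cV[R]_d) : R :=
  fine (PQ [set w | dot (matrix_of G w *m h) (matrix_of G w *m u) <= 0]).

(* Main.v *)
(** Let c and s be the cosine and the sine of the angle between h and u.  By
    rotation invariance, R h and R u are multiples of X and of c X + s Y, with
    X and Y independent Gaussian vectors of R^k; conditioning on X gives
    1 <= 2 f_k + sqrt (2 k / pi) * max (0, c) / |s|, so that min (1, 2 f_k)
    dominates the ramp min (1, max (0, 1 - L c)) with L = sqrt (1 + 2 k / pi).
    It remains to bound the margin loss of unit vectors uniformly.
    Symmetrization by a ghost sample, bounded differences on the hypercube of
    signs and the contraction principle give an excess of
    2 L / sqrt N + 2 sqrt (ln (1 / delta) / (2 N)); the gap between its last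
    term and 3 sqrt (ln (2 / delta) / (2 N)) pays for having L in place of
    sqrt (2 k / pi).  Rounding normals and points to a finite net of the unit
    ball makes all suprema and expectations over samples finite. *)

Require Import Defs.
From HB Require Import structures.
From mathcomp Require Import all_boot all_order all_algebra.
From mathcomp Require Import all_classical all_reals all_analysis.
From mathcomp Require Import measurable_realfun normal_distribution ring lra.

Set Implicit Arguments.
Unset Strict Implicit.
Unset Printing Implicit Defensive.

Import Order.TTheory GRing.Theory Num.Theory.
Import numFieldNormedType.Exports.

Local Open Scope classical_set_scope.
Local Open Scope ring_scope.

(** * Rademacher averages over finite classes *)

(** The Rademacher bound holds for every sample, not only on average. A single tail event therefore
    uses up [delta], although the target allows for [ln (2 / delta)]. Concentration is run on the
    symmetrized exponential moment itself: the maximum stays inside the exponential, and only the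
    random signs, arranged as a binary tree, have to be controlled. This doubles the fluctuation
    term (factor [2] where a direct bounded-difference argument gives [1]), which is still below the
    available [3]. The finite net also settles measurability: the bad event depends on finitely many
    cells, although it controls a supremum over all normals. The rounding error is chosen as
    [1 / (20 * sqrt N)], so that the same gap in the constants absorbs it. *)

Section rademacher.
Context {R : realType} {J : finType} (j0 : J).
Implicit Types (c a : J -> R) (s : seq (J -> R)).

Definition fmax c : R := \big[Num.max/c j0]_j c j.

Lemma fmax_ge c j : c j <= fmax c.
Proof. exact: le_bigmax. Qed.

Lemma fmax_attained c : exists j, fmax c = c j.
Proof.
rewrite /fmax; apply: (big_ind (fun x => exists j, x = c j)).
- by exists j0.
- by move=> x y [i ->] [j ->]; rewrite maxEle; case: ifP; [exists j|exists i].
- by move=> j _; exists j.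
Qed.

Lemma fmax_le c x : (forall j, c j <= x) -> fmax c <= x.
Proof. by have [j ->] := fmax_attained c. Qed.

(* The average of [F (c + \sum_i e_i a_i)] over all signs [e_i], for
   [s = [:: a_1; ...; a_n]]. *)
Fixpoint sign_avg (F : (J -> R) -> R) s c : R :=
  if s is a :: s' then (sign_avg F s' (c + a) + sign_avg F s' (c - a)) / 2
  else F c.

Local Notation rad := (sign_avg fmax).

Lemma fmax_lip c c' M : (forall j, c j <= c' j + M) -> fmax c <= fmax c' + M.
Proof.
move=> h; apply: fmax_le => j; apply: (le_trans (h j)).
by rewrite lerD2r fmax_ge.
Qed.

(** With [M = 2] this is the bounded-difference property behind [radexp_le]: reversing one sign
    moves the average of the maxima by at most [2]. *)
Lemma rad_lip s c c' M : (forall j, c j <= c' j + M) -> rad s c <= rad s c' + M.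
Proof.
elim: s c c' => [|a s IH] c c' h /=; first exact: fmax_lip.
have h1 : rad s (c + a) <= rad s (c' + a) + M.
  by apply: IH => j; rewrite !fctE addrAC lerD2r.
have h2 : rad s (c - a) <= rad s (c' - a) + M.
  by apply: IH => j; rewrite !fctE addrAC lerD2r.
lra.
Qed.

(** The second list enters with all signs reversed, which an average over all signs cannot detect.
    Hence the factor [2] on the Rademacher average after symmetrization. *)
Lemma rad_sub (s : seq ((J -> R) * (J -> R))) c d :
  rad [seq x.1 - x.2 | x <- s] (c + d) <=
  rad [seq x.1 | x <- s] c + rad [seq x.2 | x <- s] d.
Proof.
elim: s c d => [|[a b] s IH] c d /=.
  by apply: fmax_le => j; rewrite !fctE lerD ?fmax_ge.
have := IH (c + a) (d - b); have := IH (c - a) (d + b).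
rewrite (_ : c + d + (a - b) = c + a + (d - b)) 1?addrACA//.
rewrite (_ : c + d - (a - b) = c - a + (d + b)) ?opprB 1?[b - a]addrC 1?addrACA//.
lra.
Qed.

(** One step of the contraction principle. At the leaves let [i] and [j] maximize the two left-hand
    terms: the values of [phi] differ by at most [L] times the distance of [t i] and [t j], and
    distributing [i] and [j] over the two linear terms according to the order of [t i] and [t j]
    produces exactly that distance. *)
Lemma rad_contraction_step (phi : R -> R) (L : R) (t : J -> R) s c :
  (forall x y, `|phi x - phi y| <= L * `|x - y|) ->
  rad s (c + (fun j => phi (t j))) + rad s (c - (fun j => phi (t j))) <=
  rad s (c + (fun j => L * t j)) + rad s (c - (fun j => L * t j)).
Proof.
move=> lip; elim: s c => [|a s IH] c /=.
  have [i ->] := fmax_attained (c + (fun j => phi (t j))).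
  have [j ->] := fmax_attained (c - (fun j => phi (t j))).
  rewrite !fctE /=.
  have := lip (t i) (t j); have := ler_norm (phi (t i) - phi (t j)).
  have [tij|tij] := leP (t j) (t i).
    rewrite (ger0_norm (x := t i - t j)) ?subr_ge0// => h1 h2.
    have := fmax_ge (c + (fun j => L * t j)) i;
      have := fmax_ge (c - (fun j => L * t j)) j.
    by rewrite !fctE /=; lra.
  rewrite (ltr0_norm (x := t i - t j)) ?subr_lt0// => h1 h2.
  have := fmax_ge (c + (fun j => L * t j)) j;
    have := fmax_ge (c - (fun j => L * t j)) i.
  by rewrite !fctE /=; lra.
have := IH (c + a); have := IH (c - a).
rewrite !(addrAC c a) !(addrAC c (- a)); lra.
Qed.

(** The head is linearized while the tail still carries [phi]; induction then treats the tail with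
    the linear term moved into the offset [c]. *)
Lemma rad_contraction (phi : R -> R) (L : R) s c :
  (forall x y, `|phi x - phi y| <= L * `|x - y|) ->
  rad [seq (fun j => phi (t j)) | t <- s] c <= rad [seq (fun j => L * t j) | t <- s] c.
Proof.
move=> lip; elim: s c => [//|t s IH] c /=.
have := rad_contraction_step t [seq (fun j => phi (t j)) | t <- s] c lip.
have := IH (c + (fun j => L * t j)); have := IH (c - (fun j => L * t j)).
lra.
Qed.

Lemma sqrt_avg_le (x y : R) : 0 <= x -> 0 <= y ->
  (Num.sqrt x + Num.sqrt y) / 2 <= Num.sqrt ((x + y) / 2).
Proof.
move=> x0 y0; rewrite -[leLHS]ger0_norm ?divr_ge0 ?addr_ge0 ?sqrtr_ge0//.
rewrite -sqrtr_sqr ler_sqrt; last by rewrite divr_ge0 ?addr_ge0.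
have := sqr_sqrtr x0; have := sqr_sqrtr y0.
have := sqr_ge0 (Num.sqrt x - Num.sqrt y).
by rewrite !expr2; lra.
Qed.

End rademacher.

Section dot_product.
Context {R : realType} {d : nat}.
Implicit Types u v w : 'cV[R]_d.

Lemma dotE u v : dot u v = \sum_i u i 0 * v i 0.
Proof. by rewrite /dot mxE; apply: eq_bigr => i _; rewrite mxE. Qed.

Lemma dotC u v : dot u v = dot v u.
Proof. by rewrite !dotE; apply: eq_bigr => i _; rewrite mulrC. Qed.

Lemma dotDr u v w : dot u (v + w) = dot u v + dot u w.
Proof. by rewrite /dot mulmxDr mxE. Qed.

Lemma dotNr u v : dot u (- v) = - dot u v.
Proof. by rewrite /dot mulmxN mxE. Qed.

Lemma dotBr u v w : dot u (v - w) = dot u v - dot u w.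
Proof. by rewrite dotDr dotNr. Qed.

Lemma dotZr (a : R) u v : dot u (a *: v) = a * dot u v.
Proof. by rewrite /dot -scalemxAr mxE. Qed.

Lemma dotDl u v w : dot (u + v) w = dot u w + dot v w.
Proof. by rewrite dotC dotDr !(dotC w). Qed.

Lemma dotBl u v w : dot (u - v) w = dot u w - dot v w.
Proof. by rewrite dotC dotBr !(dotC w). Qed.

Lemma dotZl (a : R) u v : dot (a *: u) v = a * dot u v.
Proof. by rewrite dotC dotZr dotC. Qed.

Lemma dot_ge0 u : 0 <= dot u u.
Proof. by rewrite dotE sumr_ge0// => i _; rewrite -expr2 sqr_ge0. Qed.

Lemma dot_eq0 u : (dot u u == 0) = (u == 0).
Proof.
apply/idP/eqP => [|->]; last by rewrite dotE big1// => i _; rewrite mxE mul0r.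
rewrite dotE psumr_eq0 => [/allP h|i _]; last by rewrite -expr2 sqr_ge0.
apply/colP => i; have := h i; rewrite mem_index_enum => /(_ isT).
by rewrite -expr2 sqrf_eq0 mxE => /eqP.
Qed.

Definition enorm u := Num.sqrt (dot u u).

Lemma enorm_ge0 u : 0 <= enorm u. Proof. exact: sqrtr_ge0. Qed.

Lemma sqr_enorm u : enorm u ^+ 2 = dot u u.
Proof. by rewrite sqr_sqrtr ?dot_ge0. Qed.

Lemma enorm_eq0 u : (enorm u == 0) = (u == 0).
Proof. by rewrite -sqrf_eq0 sqr_enorm dot_eq0. Qed.

Lemma normalize_dot u : u != 0 -> dot ((enorm u)^-1 *: u) ((enorm u)^-1 *: u) = 1.
Proof.
move=> u0; rewrite dotZl dotZr -sqr_enorm.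
by have := u0; rewrite -enorm_eq0 => ?; field.
Qed.

Lemma cauchy_schwarz u v : `|dot u v| <= enorm u * enorm v.
Proof.
have [->|u0] := eqVneq u 0.
  by rewrite dotE big1 ?normr0 ?mulr_ge0 ?enorm_ge0// => i _; rewrite mxE mul0r.
rewrite -[leRHS]ger0_norm ?mulr_ge0 ?enorm_ge0//.
rewrite -ler_sqr ?nnegrE ?normr_ge0// !real_normK ?num_real//.
rewrite exprMn !sqr_enorm.
(* The residue of projecting [v] on [u], cleared of denominators: its squared norm is [dot u u]
   times the gap to be shown nonnegative. *)
have := dot_ge0 (dot u u *: v - dot u v *: u).
rewrite dotBl !dotBr !dotZl !dotZr (dotC v u).
have u1 : 0 < dot u u by rewrite lt0r dot_eq0 u0 dot_ge0.
move=> h; rewrite -subr_ge0 -(pmulr_rge0 _ u1).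
by apply: (le_trans h); rewrite le_eqVlt; apply/orP; left; apply/eqP; ring.
Qed.

(** Here [q] is the signed sum so far. Cauchy-Schwarz bounds the leaves; one level up, the
    parallelogram law adds [dot v v <= 1] to the mean of the squared norms, and concavity of the
    square root ([sqrt_avg_le]) moves the mean under the root. *)
Lemma rad_linear (J : finType) (j0 : J) (g : J -> 'cV[R]_d) (L : R) (s : seq 'cV[R]_d)
  q :
  0 <= L -> (forall j, dot (g j) (g j) <= 1) ->
  (forall v, v \in s -> dot v v <= 1) ->
  sign_avg (fmax j0) [seq (fun j => L * dot (g j) v) | v <- s]
    (fun j => L * dot (g j) q) <= L * Num.sqrt (dot q q + (size s)%:R).
Proof.
move=> L0 g1; elim: s q => [|v s IH] q s1 /=.
  rewrite addr0; apply: fmax_le => j; rewrite ler_wpM2l//.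
  apply: (le_trans (ler_norm _)); apply: (le_trans (cauchy_schwarz _ _)).
  rewrite ler_piMl ?enorm_ge0// -[leRHS]sqrtr1 ler_wsqrtr//.
have s2 w : w \in s -> dot w w <= 1 by move=> ws; apply: s1; rewrite inE ws orbT.
have := IH (q + v) s2; have := IH (q - v) s2.
rewrite (_ : (fun j => L * dot (g j) (q - v)) =
    (fun j => L * dot (g j) q) - (fun j => L * dot (g j) v)); last first.
  by apply/funext => j; rewrite !fctE dotBr mulrBr.
rewrite (_ : (fun j => L * dot (g j) (q + v)) =
    (fun j => L * dot (g j) q) + (fun j => L * dot (g j) v)); last first.
  by apply/funext => j; rewrite !fctE dotDr mulrDr.
set X := sign_avg _ _ _; set Y := sign_avg _ _ _ => h1 h2.
have := @sqrt_avg_le _ (dot (q + v) (q + v) + (size s)%:R)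
  (dot (q - v) (q - v) + (size s)%:R).
rewrite !addr_ge0 ?dot_ge0// => /(_ isT isT).
set A := Num.sqrt _; set B := Num.sqrt _ => h3.
have h4 : (A + B) / 2 <= Num.sqrt (dot q q + (size s).+1%:R).
  apply: (le_trans h3); rewrite ler_wsqrtr//.
  rewrite !(dotBl, dotBr, dotDl, dotDr) (dotC v q) -(natr1 (size s)).
  have := s1 v; rewrite mem_head => /(_ isT); lra.
apply: le_trans (ler_wpM2l L0 h4).
by rewrite mulrA mulrDr ler_pM2r ?invr_gt0// lerD.
Qed.

End dot_product.

(** * A Gaussian bound for the hyperbolic cosine *)

Section cosh_bound.
Context {R : realType}.

Lemma le_at0_of_derive_le0 (f f' : R -> R) :
  (forall x : R, is_derive x (1 : R) f (f' x)) ->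
  (forall x : R, 0 <= x -> f' x <= 0) -> forall x : R, 0 <= x -> f x <= f 0.
Proof.
move=> df f'0 x x0.
have dfx y : derivable f y (1 : R) by [].
apply: (@ler0_derive1_nincry _ f 0) => // [y y0|].
  by rewrite derive1E derive_val f'0// ltW//; move: y0; rewrite in_itv/= andbT.
apply: continuous_subspaceT => y.
exact/differentiable_continuous/derivable1_diffP/dfx.
Qed.

Lemma sinh_le_mul_cosh (x : R) : 0 <= x ->
  expR x - expR (- x) <= x * (expR x + expR (- x)).
Proof.
move=> x0; rewrite -subr_le0.
pose f (y : R) := expR y - expR (- y) - y * (expR y + expR (- y)).
rewrite -/(f x) (_ : 0 = f 0); last by rewrite /f oppr0 subrr mul0r subr0.
apply: (@le_at0_of_derive_le0 f (fun y => y * (expR (- y) - expR y))) => // [y|y y0].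
  rewrite /f; apply: is_derive_eq; rewrite /GRing.scale/=; ring.
have h : expR (- y) - expR y <= 0 by rewrite subr_le0 ler_expR; lra.
exact: (mulr_ge0_le0 y0 h).
Qed.

(** By evenness it suffices that [expR (- (x * x / 2)) * (expR x + expR (- x))] decreases on the
    nonnegative reals from its value [2] at [0]; [sinh_le_mul_cosh] gives the sign of its
    derivative. *)
Lemma cosh_le_exp_sqr (x : R) : (expR x + expR (- x)) / 2 <= expR (x ^+ 2 / 2).
Proof.
wlog x0 : x / 0 <= x => [h|].
  have [/h//|x0] := leP 0 x; have := h (- x); rewrite opprK sqrrN addrC; apply.
  by rewrite oppr_ge0 ltW.
pose f (y : R) := expR (- (y * y / 2)) * (expR y + expR (- y)).
pose f' (y : R) := expR (- (y * y / 2)) *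
  (expR y - expR (- y) - y * (expR y + expR (- y))).
have : f x <= f 0.
  apply: (@le_at0_of_derive_le0 f f') => // [y|y y0].
    rewrite /f /f'; apply: is_derive_eq; rewrite /GRing.scale/=.
    by field.
  have h : expR y - expR (- y) - y * (expR y + expR (- y)) <= 0.
    by rewrite subr_le0; exact: sinh_le_mul_cosh y0.
  exact: (mulr_ge0_le0 (expR_ge0 _) h).
rewrite /f mul0r mul0r oppr0 expR0 mul1r expRN mulrC ler_pdivrMr ?expR_gt0//.
rewrite expr2; lra.
Qed.

End cosh_bound.

(** * Uniform deviations on a finite sample space *)

Section expected_exponential.
Context {R : realType} {J : finType} (j0 : J).
Implicit Types (c a : J -> R) (s : seq (J -> R)).

Local Notation rad := (sign_avg (fmax j0)).

Definition expmax (la : R) c : R := expR (la * fmax j0 c).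

(** McDiarmid's argument on the binary tree of signs: at each node the two subtree averages differ
    by at most [2], so the bound on the hyperbolic cosine costs a factor [expR (la ^+ 2 / 2)] per
    sign. *)
Lemma radexp_le (la : R) s c : 0 <= la ->
  (forall a, a \in s -> forall j, `|a j| <= 1) ->
  sign_avg (expmax la) s c <=
  expR (la * rad s c + (size s)%:R * (la ^+ 2 / 2)).
Proof.
move=> la0; elim: s c => [|a s IH] c s1 /=.
  by rewrite /expmax mul0r addr0.
have s2 b : b \in s -> forall j, `|b j| <= 1.
  by move=> bs; apply: s1; rewrite inE bs orbT.
have a1 : forall j, `|a j| <= 1 by apply: s1; rewrite mem_head.
have := IH (c + a) s2; have := IH (c - a) s2.
have d1 : rad s (c + a) <= rad s (c - a) + 2.
  by apply: rad_lip => j; rewrite !fctE; have := a1 j; rewrite ler_norml; lra.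
have d2 : rad s (c - a) <= rad s (c + a) + 2.
  by apply: rad_lip => j; rewrite !fctE; have := a1 j; rewrite ler_norml; lra.
set x := rad s (c + a) in d1 d2 *; set y := rad s (c - a) in d1 d2 *.
set E := _%:R * _ => h1 h2.
(* Midpoint and half-difference of the two exponents; the latter is at most [la] in absolute
   value. *)
pose m := la * ((x + y) / 2) + E; pose z := la * ((x - y) / 2).
have h3 : expR (la * x + E) + expR (la * y + E) =
    expR m * (expR z + expR (- z)).
  by rewrite mulrDr -!expRD; congr (expR _ + expR _); rewrite /m /z; field.
apply: (@le_trans _ _ (expR m * expR (la ^+ 2 / 2))).
  apply: (@le_trans _ _ (expR m * ((expR z + expR (- z)) / 2))).
    by rewrite mulrA -h3; lra.
  rewrite ler_wpM2l ?expR_ge0//; apply: (le_trans (cosh_le_exp_sqr _)).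
  rewrite ler_expR ler_pM2r ?invr_gt0// /z exprMn ler_piMr ?sqr_ge0//.
  rewrite -[leLHS]real_normK ?num_real// expr_le1// ler_norml; apply/andP; lra.
by rewrite -expRD ler_expR /m /E -(natr1 (size s)); lra.
Qed.

End expected_exponential.

Section product_expectation.
Context {R : realType} {K : finType} (p : K -> R).
Hypotheses (p0 : forall x, 0 <= p x) (p1 : \sum_x p x = 1).
Implicit Types F G : seq K -> R.

(** [F] acts on sequences, not on tuples, so that fixing the first point leaves a function of the
    same type and induction on [n] is possible. *)
Definition iid_sum n F := \sum_(t : n.-tuple K) (\prod_(x <- t) p x) * F t.

Lemma sum_tuple_cons n (F : n.+1.-tuple K -> R) :
  \sum_t F t = \sum_x \sum_(t : n.-tuple K) F [tuple of x :: t].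
Proof.
rewrite pair_big/=; pose f (u : K * n.-tuple K) := [tuple of u.1 :: u.2].
rewrite (reindex f)//=; exists (fun t => (thead t, [tuple of behead t])) => /=.
  by move=> [x t] _ /=; rewrite theadE; congr (_, _); exact/val_inj.
by move=> t _; rewrite /f/= -tuple_eta.
Qed.

Lemma iid_sum0 F : iid_sum 0 F = F [::].
Proof.
rewrite /iid_sum (eq_bigr (fun=> F [::])) => [|t _].
  by rewrite sumr_const card_tuple expn0.
by rewrite (tuple0 t)/= big_nil mul1r.
Qed.

Lemma iid_sumS n F :
  iid_sum n.+1 F = \sum_x p x * iid_sum n (fun s => F (x :: s)).
Proof.
rewrite /iid_sum sum_tuple_cons; apply: eq_bigr => x _.
by rewrite mulr_sumr; apply: eq_bigr => t _; rewrite big_cons mulrA.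
Qed.

Lemma le_iid_sum n F G :
  (forall s, size s = n -> F s <= G s) -> iid_sum n F <= iid_sum n G.
Proof.
move=> h; apply: ler_sum => t _; rewrite ler_wpM2l ?h ?size_tuple//.
exact: prodr_ge0.
Qed.

Lemma iid_sum_cst n (M : R) : iid_sum n (fun=> M) = M.
Proof.
elim: n => [|n IH]; first exact: iid_sum0.
by rewrite iid_sumS IH -mulr_suml p1 mul1r.
Qed.

Lemma iid_sumD n F G :
  iid_sum n (fun s => F s + G s) = iid_sum n F + iid_sum n G.
Proof. by rewrite -big_split/=; apply: eq_bigr => t _; rewrite mulrDr. Qed.

Lemma iid_sumZ n F (M : R) : iid_sum n (fun s => F s * M) = iid_sum n F * M.
Proof. by rewrite mulr_suml; apply: eq_bigr => t _; rewrite mulrA. Qed.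

End product_expectation.

Section symmetrization.
Context {R : realType} {J K : finType} (j0 : J) (p : K -> R).
Hypotheses (p0 : forall x, 0 <= p x) (p1 : \sum_x p x = 1).
Variables (la : R) (f : K -> J -> R).
Hypothesis la0 : 0 <= la.
Local Notation rad := (sign_avg (fmax j0)).

Definition mean : J -> R := fun j => \sum_x p x * f x j.

Definition deviation (s : seq K) : J -> R := \sum_(x <- s) (mean - f x).

(** The offset [c] collects the contribution of the points already drawn. *)
Definition expdev n c := iid_sum p n (fun s => expmax j0 la (c + deviation s)).

(** Tangent line at the mean: [expR (b x) >= expR m * (1 + (b x - m))], whose linear part averages
    to zero. *)
Lemma expR_jensen (b : K -> R) :
  expR (\sum_x p x * b x) <= \sum_x p x * expR (b x).
Proof.
set m := \sum_x p x * b x.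
have h : \sum_x p x * (expR m * (1 + (b x - m))) = expR m.
  transitivity (expR m * (\sum_x p x + (m - (\sum_x p x) * m))).
    rewrite /m mulr_suml -sumrB -big_split/= mulr_sumr; apply: eq_bigr => x _.
    rewrite -/m; ring.
  by rewrite p1 mul1r subrr addr0 mulr1.
rewrite -[leLHS]h; apply: ler_sum => x _; rewrite ler_wpM2l//.
by rewrite -[in leRHS](subrKC m (b x)) expRD ler_wpM2l ?expR_ge0 ?expR_ge1Dx.
Qed.

Lemma expmax_jensen (b : K -> J -> R) :
  expmax j0 la (fun j => \sum_x p x * b x j) <= \sum_x p x * expmax j0 la (b x).
Proof.
rewrite /expmax; have [j ->] := fmax_attained j0 (fun j => \sum_x p x * b x j).
rewrite mulr_sumr.
rewrite (eq_bigr (fun x => p x * (la * b x j))); last by move=> x _; ring.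
apply: (le_trans (expR_jensen _)); apply: ler_sum => x _.
by rewrite ler_wpM2l// ler_expR ler_wpM2l// fmax_ge.
Qed.

Lemma expdevS n c : expdev n.+1 c = \sum_x p x * expdev n (c + (mean - f x)).
Proof.
rewrite /expdev iid_sumS; apply: eq_bigr => x _; congr (_ * iid_sum _ _ _).
by apply/funext => s; rewrite /deviation big_cons addrA.
Qed.

Lemma expdev_jensen n (b : K -> J -> R) :
  expdev n (fun j => \sum_x p x * b x j) <= \sum_x p x * expdev n (b x).
Proof.
elim: n b => [|n IH] b.
  rewrite /expdev iid_sum0 /deviation big_nil addr0.
  under eq_bigr do rewrite iid_sum0 big_nil addr0.
  exact: expmax_jensen.
rewrite expdevS; under [leRHS]eq_bigr do rewrite expdevS mulr_sumr.
rewrite exchange_big/=; apply: ler_sum => y _.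
under [leRHS]eq_bigr do rewrite mulrCA.
rewrite -mulr_sumr ler_wpM2l//.
rewrite (_ : _ + _ = fun j => \sum_x p x * (b x + (mean - f y)) j)//.
apply/funext => j; rewrite !fctE.
under [RHS]eq_bigr do rewrite mulrDr.
by rewrite big_split/= -mulr_suml p1 mul1r.
Qed.

Definition pair_weight (u : K * K) := p u.1 * p u.2.

(* The mean is the average over a ghost point, which Jensen's inequality moves
   out of the exponential; exchanging it with the sample point introduces the
   sign. *)
Lemma expdev_symmetrization n c : expdev n c <=
  iid_sum pair_weight n (fun s =>
    sign_avg (expmax j0 la) [seq f u.1 - f u.2 | u <- s] c).
Proof.
elim: n c => [|n IH] c.
  by rewrite /expdev !iid_sum0 /deviation big_nil addr0.
have h1 : expdev n.+1 c <=
    \sum_y \sum_x p x * p y * expdev n (c + (f x - f y)).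
  rewrite expdevS; apply: ler_sum => y _.
  under [leRHS]eq_bigr do rewrite (mulrC (p _)) -mulrA.
  rewrite -mulr_sumr ler_wpM2l//; apply: le_trans (expdev_jensen _ _).
  rewrite le_eqVlt; apply/orP; left; apply/eqP; congr (expdev n _).
  apply/funext => j; rewrite !fctE.
  under [RHS]eq_bigr do rewrite mulrDr mulrBr.
  by rewrite big_split/= sumrB -!mulr_suml p1 !mul1r.
apply: (le_trans h1); rewrite iid_sumS.
have h2 : \sum_y \sum_x p x * p y * expdev n (c + (f x - f y)) =
    \sum_y \sum_x p x * p y * expdev n (c - (f x - f y)).
  rewrite exchange_big/=; apply: eq_bigr => x _; apply: eq_bigr => y _.
  by rewrite opprB (mulrC (p y)).
have h3 : \sum_y \sum_x p x * p y * expdev n (c + (f x - f y)) =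
    \sum_y \sum_x p x * p y *
      ((expdev n (c + (f x - f y)) + expdev n (c - (f x - f y))) / 2).
  rewrite [LHS](_ : _ = (\sum_y \sum_x p x * p y * expdev n (c + (f x - f y))
    + \sum_y \sum_x p x * p y * expdev n (c - (f x - f y))) / 2); last by lra.
  rewrite -big_split/= mulr_suml; apply: eq_bigr => y _.
  rewrite -big_split/= mulr_suml; apply: eq_bigr => x _.
  by rewrite -mulrDr mulrA.
rewrite h3 exchange_big pair_big/=; apply: ler_sum => -[x y] _ /=.
rewrite ler_wpM2l ?mulr_ge0// iid_sumZ iid_sumD.
by rewrite ler_pM2r ?invr_gt0// lerD.
Qed.

(** The symmetrized increments [f x - f y] lie in [[-1, 1]], and [rad_sub] bounds their average by
    one Rademacher average for each half of the doubled sample, hence [2 * rho]. *)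
Lemma expdev_le n (rho : R) :
  (forall x j, 0 <= f x j <= 1) ->
  (forall s, size s = n -> rad [seq f x | x <- s] 0 <= rho) ->
  expdev n 0 <= expR (la * (2 * rho) + n%:R * (la ^+ 2 / 2)).
Proof.
move=> f01 hrho; apply: (le_trans (expdev_symmetrization _ _)).
have q0 u : 0 <= pair_weight u by rewrite mulr_ge0.
have q1 : \sum_u pair_weight u = 1.
  rewrite -(pair_big xpredT xpredT (fun x y => p x * p y))/=.
  by under eq_bigr do rewrite -mulr_sumr p1 mulr1.
rewrite -[leRHS](iid_sum_cst q1 n); apply: le_iid_sum => // s sn.
apply: (le_trans (radexp_le _ _ la0 _)).
  move=> a /mapP[[x y] _ ->] j; rewrite !fctE ler_norml.
  by have := f01 x j; have := f01 y j; lra.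
rewrite ler_expR size_map sn lerD2r ler_wpM2l//.
have := rad_sub j0 [seq (f u.1, f u.2) | u <- s] 0 0.
rewrite -!map_comp addr0 => /le_trans; apply.
have := hrho [seq u.1 | u <- s]; have := hrho [seq u.2 | u <- s].
by rewrite !size_map -!map_comp => /(_ sn) + /(_ sn); rewrite /comp/=; lra.
Qed.

(** Chernoff's method: a tuple in the event has [expmax] at least [expR (la * b)]. *)
Lemma deviation_prob_le n (rho b : R) :
  (forall x j, 0 <= f x j <= 1) ->
  (forall s, size s = n -> rad [seq f x | x <- s] 0 <= rho) ->
  \sum_(t : n.-tuple K | b < fmax j0 (deviation t)) \prod_(x <- t) p x <=
  expR (la * (2 * rho) + n%:R * (la ^+ 2 / 2) - la * b).
Proof.
move=> f01 hrho; rewrite expRB ler_pdivlMr ?expR_gt0//.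
apply: le_trans (expdev_le f01 hrho).
rewrite /expdev /iid_sum big_mkcond mulr_suml; apply: ler_sum => t _.
have pt : 0 <= \prod_(x <- t) p x by exact: prodr_ge0.
case: ifPn => [bt|_]; last by rewrite mul0r mulr_ge0// expR_ge0.
by rewrite ler_wpM2l// add0r /expmax ler_expR ler_wpM2l// ltW.
Qed.

End symmetrization.

(** * Margin bound *)

Section margin_bound.
Context {R : realType} {d : nat} {J K : finType} (j0 : J) (p : K -> R).
Hypotheses (p0 : forall x, 0 <= p x) (p1 : \sum_x p x = 1).
Variables (g : J -> 'cV[R]_d) (v : K -> 'cV[R]_d).
Hypotheses (g1 : forall j, dot (g j) (g j) <= 1) (v1 : forall x, dot (v x) (v x) <= 1).
Variables (phi : R -> R) (L : R).
Hypotheses (L0 : 0 <= L) (phi01 : forall x, 0 <= phi x <= 1).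
Hypothesis lip : forall x y, `|phi x - phi y| <= L * `|x - y|.

Let loss x j := phi (dot (g j) (v x)).

Lemma margin_bound n (delta : R) : (0 < n)%N -> 0 < delta <= 1 ->
  \sum_(t : n.-tuple K |
      2 * L * Num.sqrt n%:R + Num.sqrt (2 * n%:R * ln delta^-1) <
      fmax j0 (deviation p loss t)) \prod_(x <- t) p x <= delta.
Proof.
move=> n0 /andP[d0 d1].
set r := Num.sqrt (_ * ln _); set rho := L * Num.sqrt n%:R.
have l0 : 0 <= ln delta^-1 by rewrite ln_ge0// invf_ge1.
have nR : (0 : R) < n%:R by rewrite ltr0n.
have r0 : 0 <= r by exact: sqrtr_ge0.
have hrho s : size s = n ->
    sign_avg (fmax j0) [seq loss x | x <- s] 0 <= rho.
  move=> sn;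
    have := rad_contraction j0 [seq (fun j => dot (g j) w) | w <- [seq v x | x <- s]] 0
    lip.
  rewrite -!map_comp => /le_trans; apply.
  have := @rad_linear _ _ _ j0 g L [seq v x | x <- s] 0 L0 g1.
  have -> : (fun j => L * dot (g j) (0 : 'cV_d)) = 0.
    by apply/funext => j; rewrite -(scale0r 0) dotZr mul0r mulr0.
  rewrite -map_comp size_map sn (_ : dot 0 0 = 0) ?add0r; last first.
    by apply/eqP; rewrite dot_eq0.
  by apply => w /mapP[x _ ->].
(* The value [la = r / n] minimizes [n * la ^+ 2 / 2 - la * r]; the minimum [- r ^+ 2 / (2 * n)]
   equals [ln delta] by the choice of [r]. *)
have la0 : 0 <= r / n%:R by rewrite divr_ge0// ltW.
have := @deviation_prob_le _ _ _ j0 p p0 p1 _ loss la0 n rho (2 * rho + r)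
  (fun x j => phi01 _) hrho => h.
rewrite -mulrA -/rho; apply: (le_trans h).
have r2 : r ^+ 2 = 2 * n%:R * ln delta^-1.
  by rewrite sqr_sqrtr// mulr_ge0// mulr_ge0// ltW.
rewrite -[leRHS]lnK ?posrE// -[X in ln X]invrK lnV ?posrE ?invr_gt0//.
rewrite ler_expR le_eqVlt; apply/orP; left; apply/eqP.
transitivity (- (r ^+ 2 / (2 * n%:R))); first by field; rewrite gt_eqF.
by rewrite r2; field; rewrite gt_eqF.
Qed.

End margin_bound.

(** * From an i.i.d. sample to a finite sample space *)

Section finite_measure_additivity.
Context {R : realType} {d : measure_display} {T : measurableType d}.

Lemma measure_fin_preimage (mu : {measure set T -> \bar R}) (K : finType)
    (kappa : T -> K) (B : pred K) :
  (forall k, measurable (kappa @^-1` [set k])) ->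
  measurable [set x | B (kappa x)] /\
  mu [set x | B (kappa x)] = (\sum_(k | B k) mu (kappa @^-1` [set k]))%E.
Proof.
move=> mk.
have -> : [set x | B (kappa x)] = \bigcup_(k in [set` B]) (kappa @^-1` [set k]).
  apply/seteqP; split => [x /= Bx|x [k Bk] /= xk]; last by rewrite xk.
  by exists (kappa x).
split; first exact: fin_bigcup_measurable.
rewrite measure_fin_bigcup//; last first.
  apply/trivIsetP => i j _ _ /eqP ij; apply/seteqP; split => // x [/= xi xj].
  by apply: ij; rewrite -xi -xj.
rewrite -(@bigfs _ _ _ _ (index_enum K)) ?index_enum_uniq// => i _.
by rewrite mem_index_enum.
Qed.

End finite_measure_additivity.

Section iid_discretization.
Context {R : realType} {dO dT : measure_display} {O : measurableType dO}
  {T : measurableType dT} (P : probability O R) (D : probability T R).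
Context {N : nat} (S : 'I_N -> {RV P >-> T}) (S_iid : iid S D).
Context {K : finType} (kappa : T -> K).
Hypothesis mkappa : forall k, measurable (kappa @^-1` [set k]).

Definition cell_prob k := fine (D (kappa @^-1` [set k])).

Lemma cell_probE k : (cell_prob k)%:E = D (kappa @^-1` [set k]).
Proof. by rewrite fineK// fin_num_measure. Qed.

Lemma cell_prob_ge0 k : 0 <= cell_prob k.
Proof. by rewrite fine_ge0. Qed.

Lemma sum_cell_prob (B : pred K) :
  (\sum_(k | B k) cell_prob k)%:E = D [set x | B (kappa x)].
Proof.
have [_ ->] := measure_fin_preimage D B mkappa.
by rewrite -sumEFin; apply: eq_bigr => k _; rewrite cell_probE.
Qed.

Lemma sum_cell_prob1 : \sum_k cell_prob k = 1.
Proof.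
apply/EFin_inj;
  rewrite (sum_cell_prob predT) (_ : [set x | _] = setT) ?probability_setT//.
by apply/seteqP; split.
Qed.

(** The fibre of the discretized sample over a tuple is a box of cells, so independence and the
    common law give exactly the weights of [iid_sum]. *)
Lemma iid_discretized (B : pred (N.-tuple K)) :
  measurable [set w | B [tuple kappa (S i w) | i < N]] /\
  P [set w | B [tuple kappa (S i w) | i < N]] =
    (\sum_(t | B t) \prod_(x <- t) cell_prob x)%:E.
Proof.
pose kap w := [tuple kappa (S i w) | i < N].
have kapE t : kap @^-1` [set t] =
    \bigcap_(i in [set` [set: 'I_N]%SET]) S i @^-1` (kappa @^-1` [set tnth t i]).
  apply/seteqP; split => [w /= <- i _ /=|w /= h]; first by rewrite tnth_mktuple.
  by apply/eq_from_tnth => i; rewrite tnth_mktuple; apply: h; rewrite /= inE.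
have mS i t : measurable (S i @^-1` (kappa @^-1` [set tnth t i])).
  by rewrite -[X in measurable X]setTI; exact: measurable_funP.
have mkap t : measurable (kap @^-1` [set t]).
  by rewrite kapE; apply: fin_bigcap_measurable => //; exact: finite_finset.
have [mB ->] := measure_fin_preimage P B mkap; split => //.
rewrite -sumEFin; apply: eq_bigr => t _; rewrite kapE.
have [ind law] := S_iid.
apply: (etrans (ind [set: 'I_N]%SET (fun i => kappa @^-1` [set tnth t i]) _)) => //.
rewrite big_tuple -prodEFin; apply: eq_big => [i|i _]; first by rewrite inE.
by rewrite cell_probE -(law i).
Qed.

End iid_discretization.

(** * The ramp loss and rounding to a finite net *)

Section clip.
Context {R : realType}.
Implicit Types x y : R.

Definition clip x : R := Num.max 0 (Num.min 1 x).

Lemma clip01 x : 0 <= clip x <= 1.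
Proof. by rewrite /clip le_max lexx/= ge_max ler01 ge_min lexx. Qed.

Lemma clip_ge x : 1 <= x -> clip x = 1.
Proof. by move=> x1; rewrite /clip (min_idPl _)//; apply/max_idPr. Qed.

Lemma clip_min x y : 0 <= y -> Num.min 1 x <= y -> clip x <= Num.min 1 y.
Proof. by move=> y0 xy; rewrite /clip ge_max !le_min ler01 y0 ge_min lexx xy. Qed.

Lemma le_clipD x y e : 0 <= e -> x <= y + e -> clip x <= clip y + e.
Proof.
move=> e0 xy; have /andP[c0 c1] := clip01 y; rewrite {1}/clip ge_max addr_ge0//=.
have [h|h] := leP 1 y; first by rewrite (clip_ge h) ge_min lerDl e0.
rewrite ge_min; apply/orP; right; apply: (le_trans xy); rewrite lerD2r.
by rewrite /clip le_max le_min (ltW h) lexx orbT.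
Qed.

Lemma clip_lip x y : `|clip x - clip y| <= `|x - y|.
Proof.
rewrite ler_norml lerBlDl lerNl opprB lerBlDl.
rewrite !le_clipD// -lerBlDl; first exact: ler_norm.
by rewrite distrC ler_norm.
Qed.

End clip.

Section ball_net.
Context {R : realType} {d : nat}.

Lemma enorm_le_of_coord (u : 'cV[R]_d) (e : R) : 0 <= e ->
  (forall i, `|u i 0| <= e) -> enorm u <= d%:R * e.
Proof.
move=> e0 ue; rewrite -[leRHS]ger0_norm ?mulr_ge0// -sqrtr_sqr ler_wsqrtr//.
rewrite dotE; apply: (@le_trans _ _ (\sum_(i < d) e ^+ 2)).
  by apply: ler_sum => i _; rewrite -expr2 -real_normK ?num_real// ler_sqr ?nnegrE.
rewrite sumr_const card_ord -[leLHS]mulr_natl exprMn ler_wpM2r ?sqr_ge0//.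
by rewrite -natrX ler_nat; case: (d) => // m; rewrite -mulnn leq_pmulr.
Qed.

(* Two points of [-1, 1]^d passing the same tests m/M - 1 <= x_i have
   coordinates within 1/M of each other. *)
Lemma ball_net (e : R) : 0 < e ->
  exists (K : finType) (q : 'cV[R]_d -> K) (v : K -> 'cV[R]_d),
  [/\ forall k, dot (v k) (v k) <= 1,
      forall x, dot x x <= 1 -> enorm (x - v (q x)) <= e &
      forall (dT : measure_display) (T : measurableType dT) (f : T -> 'cV[R]_d),
        (forall i, measurable_fun [set: T] (fun z => f z i 0)) ->
        forall k, measurable [set z | q (f z) = k]].
Proof.
(* Coordinates will agree up to [1 / M], hence vectors up to [d / M], which this [M] makes at most
   [e]. *)
move=> e0; pose M := (Num.truncn (d%:R / e)).+1.
have M0 : (0 : R) < M%:R by rewrite ltr0n.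
have dM : d%:R / M%:R <= e.
  by rewrite ler_pdivrMr// mulrC -ler_pdivrMr// ltW// /M truncnS_gt.
pose level (m : nat) : R := m%:R / M%:R - 1.
(* The [2 M + 1] levels run from [-1] to [1] in steps of [1 / M], both ends included. *)
pose q (x : 'cV[R]_d) : {ffun 'I_d * 'I_(M.*2.+1) -> bool} :=
  [ffun u : 'I_d * 'I_(M.*2.+1) => level u.2 <= x u.1 0].
(* A representative in the unit ball with code [k]; the default [0], for codes that no point of the
   ball has, lies in the ball as well. *)
pose v k : 'cV[R]_d := xget 0 [set x | dot x x <= 1 /\ q x = k].
have v1 k : dot (v k) (v k) <= 1.
  rewrite /v; case: xgetP => [y -> []//|_].
  by rewrite -(scale0r 0) dotZr mul0r.
have coord1 (x : 'cV[R]_d) i : dot x x <= 1 -> `|x i 0| <= 1.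
  move=> x1; rewrite -(@expr_le1 _ 2)// real_normK ?num_real//.
  apply: le_trans x1; rewrite dotE (bigD1 i)//= -expr2 lerDl.
  by rewrite sumr_ge0// => j _; rewrite -expr2 sqr_ge0.
have close (x y : 'cV[R]_d) i : dot x x <= 1 -> dot y y <= 1 -> q x = q y ->
    y i 0 - x i 0 <= M%:R^-1.
  move=> x1 /coord1 - /(_ i); rewrite ler_norml => /andP[ya yb] qxy.
  have y2 : 0 <= M%:R * (y i 0 + 1).
    by apply: mulr_ge0; [exact: ltW|lra].
  (* The highest level not above [y i 0]. As [x] passes this test too, [x i 0] exceeds
     [y i 0 - 1 / M]. *)
  pose m := Num.truncn (M%:R * (y i 0 + 1)).
  have /andP[m1 m2] := truncn_itv y2.
  have mM : (m < M.*2.+1)%N.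
    rewrite ltnS -(ler_nat R); apply: (le_trans m1).
    by rewrite -muln2 natrM ler_pM2l//; lra.
  have := congr1 (fun b : {ffun _ -> bool} => b (i, Ordinal mM)) qxy;
    rewrite /q !ffunE/=.
  have -> : level m <= y i 0.
    by rewrite /level lerBlDr ler_pdivrMr// mulrC.
  move=> mx.
  have yM : y i 0 + 1 < (m%:R + 1) / M%:R.
    by rewrite ltr_pdivlMr// mulrC natr1.
  by move: yM mx; rewrite /level mulrDl mul1r; lra.
exists {ffun 'I_d * 'I_(M.*2.+1) -> bool}, q, v; split => // [x x1|].
- apply: le_trans dM.
  have [vx1 qv] : dot (v (q x)) (v (q x)) <= 1 /\ q (v (q x)) = q x.
    by rewrite /v; case: xgetP => [y -> []//|/(_ x)[]].
  apply: enorm_le_of_coord; first by rewrite invr_ge0 ltW.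
  by move=> i; rewrite !mxE ler_norml lerNl opprB !close.
- move=> dT T f mf k.
  rewrite (_ : [set z | _] = \bigcap_(u in [set: 'I_d * 'I_(M.*2.+1)])
      [set z | (level u.2 <= f z u.1 0) = k u]).
    apply: fin_bigcap_measurable => // u _.
    rewrite -[X in measurable X]setTI.
    apply: (@measurable_fun_ler _ _ _ _ (cst (level u.2)) (fun z => f z u.1 0) _ _ _
      [set k u]) => //.
  apply/seteqP; split => [z /= <- u _ /=|z h]; first by rewrite ffunE.
  by apply/ffunP => u; rewrite ffunE; exact: h.
Qed.

End ball_net.

(* [normalize 0 = 0], so a zero normal or point has cosine 0. *)
Definition normalize {R : realType} {d : nat} (u : 'cV[R]_d) : 'cV[R]_d :=
  (enorm u)^-1 *: u.

Lemma normalize_le1 {R : realType} {d : nat} (u : 'cV[R]_d) :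
  dot (normalize u) (normalize u) <= 1.
Proof.
have [->|u0] := eqVneq u 0; last by rewrite normalize_dot.
by rewrite /normalize scaler0 -(scale0r 0) dotZr mul0r.
Qed.

Section measurability.
Context {R : realType} {d : nat}.

Lemma measurable_signed_point i : measurable_fun [set: d.-tuple R * bool]
  (fun z => (signed_point z : 'cV[R]_d) i 0).
Proof.
have -> : (fun z => (signed_point z : 'cV[R]_d) i 0) =
    fun z : d.-tuple R * bool => label_val z.2 * tnth z.1 i.
  by apply/funext => z; rewrite /signed_point !mxE.
apply: measurable_funM.
- exact: (@measurableT_comp _ _ _ _ _ _ (@label_val R)).
- exact: (measurableT_comp (measurable_tnth i) measurable_fst).
Qed.

Lemma measurable_sqrt : measurable_fun [set: R] (@Num.sqrt R).
Proof. by apply: nondecreasing_measurable => // x y; exact: ler_wsqrtr. Qed.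

Lemma measurable_normalize (dT : measure_display) (T : measurableType dT)
    (f : T -> 'cV[R]_d) :
  (forall i, measurable_fun [set: T] (fun z => f z i 0)) ->
  forall i, measurable_fun [set: T] (fun z => normalize (f z) i 0).
Proof.
move=> mf i.
have -> : (fun z => normalize (f z) i 0) = fun z =>
    (Num.sqrt (\sum_j f z j 0 * f z j 0)) `^ (-1) * f z i 0.
  by apply/funext => z; rewrite /normalize mxE powR_inv1 ?sqrtr_ge0// /enorm dotE.
apply: measurable_funM => //.
apply: (@measurableT_comp _ _ _ _ _ _ (fun x : R => x `^ (-1))).
  exact: measurable_powR.
apply: (@measurableT_comp _ _ _ _ _ _ (@Num.sqrt R)).
  exact: measurable_sqrt.
by apply: measurable_sum => j; exact: measurable_funM.
Qed.

End measurability.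

Section flip_prob_facts.
Context {dQ : measure_display} {Q : measurableType dQ} {R : realType}
  {PQ : probability Q R} {k d : nat} (G : 'I_k * 'I_d -> {RV PQ >-> R}).

Lemma flip_prob_ge0 h u : 0 <= flip_prob G h u.
Proof. by rewrite fine_ge0. Qed.

Lemma flip_prob_degenerate h u : h = 0 \/ u = 0 -> flip_prob G h u = 1.
Proof.
move=> hu; rewrite /flip_prob (_ : [set w | _] = setT) ?probability_setT//.
apply/seteqP; split => // w _ /=.
by case: hu => ->; rewrite mulmx0 /dot ?mulmx0 ?trmx0 ?mul0mx mxE.
Qed.

End flip_prob_facts.

(** * Numerical slack between the two sets of constants *)

Section slack.
Context {R : realType}.

Lemma ln2_ge_half : 1 / 2 <= ln (2 : R).
Proof.
have h : ln (1 + (- (1 / 2))) <= - (1 / 2) :> R by apply: le_ln1Dx; lra.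
have e : 1 + (- (1 / 2)) = 2^-1 :> R by lra.
by move: h; rewrite e lnV ?posrE//; lra.
Qed.

Lemma le_of_sqr (x y : R) : 0 <= y -> x * x <= y * y -> x <= y.
Proof.
move=> y0; rewrite -!expr2 => xy; apply: (le_trans (ler_norm x)).
by rewrite -(ler_sqr (x := `|x|)) ?nnegrE// real_normK ?num_real.
Qed.

(* With y and w the two square roots, w^2 - y^2 = ln 2 / 2 and
   (3 w - 2 y)^2 - 5 (w^2 - y^2) = (2 w - 3 y)^2 bound 3 w - 2 y from below. *)
Lemma margin_slack (a L x : R) : 1 / 2 <= a ^+ 2 -> 0 <= a -> 0 <= L ->
  L ^+ 2 = 1 + a ^+ 2 -> 0 <= x ->
  2 * L + 2 * Num.sqrt (x / 2) + 1 / 20 <=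
  2 * a + 3 * Num.sqrt ((ln 2 + x) / 2).
Proof.
rewrite !expr2 => a2 a0 L0 La x0; have l2 := ln2_ge_half.
set y := Num.sqrt (x / 2); set w := Num.sqrt _.
have y0 : 0 <= y by exact: sqrtr_ge0.
have w0 : 0 <= w by exact: sqrtr_ge0.
have hy : y * y = x / 2 by rewrite -expr2 sqr_sqrtr//; lra.
have hw : w * w = (ln 2 + x) / 2 by rewrite -expr2 sqr_sqrtr//; lra.
(* The constants balance: with [L - a <= 21 / 40], the excess is at most
   [2 * (21 / 40) + 1 / 20 = 11 / 10], which bounds [3 * w - 2 * y] from below since the square of
   the latter is at least [5 * ln 2 / 2 >= 5 / 4]. *)
have a1 : 7 / 10 <= a by apply: le_of_sqr => //; lra.
have LA : L <= a + 21 / 40 by apply: le_of_sqr; lra.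
have yw : y <= w by apply: le_of_sqr => //; lra.
have wy : 11 / 10 <= 3 * w - 2 * y.
  have h : 0 <= (2 * w - 3 * y) * (2 * w - 3 * y) by rewrite -expr2 sqr_ge0.
  by apply: le_of_sqr; lra.
by lra.
Qed.

End slack.

Lemma dot_perturbation {R : realType} {d : nat} (x y x' y' : 'cV[R]_d) (e : R) :
  enorm x <= 1 -> enorm y' <= 1 -> enorm (x - x') <= e -> enorm (y - y') <= e ->
  `|dot x y - dot x' y'| <= 2 * e.
Proof.
move=> x1 y1 xe ye.
have -> : dot x y - dot x' y' = dot x (y - y') + dot (x - x') y'.
  by rewrite dotBr dotBl; lra.
apply: (le_trans (ler_normD _ _)).
have h1 := cauchy_schwarz x (y - y'); have h2 := cauchy_schwarz (x - x') y'.
have h3 : enorm x * enorm (y - y') <= 1 * e by rewrite ler_pM ?enorm_ge0.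
have h4 : enorm (x - x') * enorm y' <= e * 1 by rewrite ler_pM ?enorm_ge0.
lra.
Qed.

Lemma dot_normalize_le0 {R : realType} {d : nat} (x y : 'cV[R]_d) :
  dot x y <= 0 -> dot (normalize x) (normalize y) <= 0.
Proof.
move=> xy; rewrite dotZl dotZr.
by rewrite mulr_ge0_le0 ?mulr_ge0_le0 ?invr_ge0 ?enorm_ge0.
Qed.

Lemma enorm_le1 {R : realType} {d : nat} (x : 'cV[R]_d) :
  dot x x <= 1 -> enorm x <= 1.
Proof. by move=> x1; rewrite /enorm -[leRHS]sqrtr1 ler_wsqrtr. Qed.

(** * The margin bound, uniformly over all normals *)

Section uniform_margin_bound.
Context {R : realType} {d N : nat} {dO : measure_display}
  {O : measurableType dO} (P : probability O R)
  (D : probability (d.-tuple R * bool)%type R)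
  (S : 'I_N -> {RV P >-> (d.-tuple R * bool)%type}).

Let cosine (h : 'cV[R]_d) z := dot (normalize h) (normalize (signed_point z)).

(** Normals and points are rounded to one net, which changes cosines by at most [2 * eps]. Shifting
    the ramp by that amount keeps the rounded loss equal to [1] at misclassified points, at a cost
    paid on the empirical side. *)
Lemma uniform_margin_bound (L e delta : R) : (0 < N)%N -> iid S D ->
  0 < L -> 0 < e -> 0 < delta <= 1 ->
  with_probability_at_least P (1 - delta) [set w | forall h,
    generalization_error D h <=
      N%:R^-1 * (\sum_(n < N) clip (1 - L * cosine h (S n w)))
      + N%:R^-1 * (2 * L * Num.sqrt N%:R + Num.sqrt (2 * N%:R * ln delta^-1)) + e].
Proof.
move=> N0 S_iid L0 e0 d01.
have N0R : (0 : R) < N%:R by rewrite ltr0n.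
(* The shift of the ramp and the rounding each displace the cosine by up to [2 * eps]; together, and
   times the slope [L], this makes [e]. *)
pose eps := e / (4 * L).
have eps0 : 0 < eps by rewrite divr_gt0// mulr_gt0.
have Leps : 4 * (L * eps) = e by rewrite /eps; field; rewrite gt_eqF.
have [K [q [v [v1 vq mq]]]] := @ball_net R d _ eps0.
pose kappa (z : d.-tuple R * bool) := q (normalize (signed_point z)).
have mkappa k : measurable (kappa @^-1` [set k]).
  apply: (mq _ _ (fun z => normalize (signed_point z))).
  by apply: measurable_normalize; exact: measurable_signed_point.
pose p := cell_prob D kappa.
have p0 : forall k, 0 <= p k by exact: cell_prob_ge0.
have p1 : \sum_k p k = 1 by exact: sum_cell_prob1.
pose phi (t : R) := clip (1 - L * (t - 2 * eps)).
have phi01 t : 0 <= phi t <= 1 by exact: clip01.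
have lip x y : `|phi x - phi y| <= L * `|x - y|.
  apply: (le_trans (clip_lip _ _)).
  have -> : 1 - L * (x - 2 * eps) - (1 - L * (y - 2 * eps)) = - (L * (x - y)).
    by ring.
  by rewrite normrN normrM (gtr0_norm L0).
pose loss k j := phi (dot (v j) (v k)).
pose b := 2 * L * Num.sqrt N%:R + Num.sqrt (2 * N%:R * ln delta^-1).
pose j0 := q 0.
have bad_le := @margin_bound R d K K j0 p p0 p1 v v v1 v1 phi L (ltW L0) phi01 lip
  N delta N0 d01.
have [mbad Pbad] := iid_discretized S_iid mkappa
  (fun t => b < fmax j0 (deviation p loss t)).
set bad := [set w | _] in mbad Pbad.
exists (~` bad); first exact: measurableC.
split.
  by rewrite probability_setC// Pbad -EFinB lee_fin lerD2l lerN2.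
move=> w /negP; rewrite -leNgt => good h /=.
pose j := q (normalize h).
have hj : enorm (normalize h - v j) <= eps by exact/vq/normalize_le1.
have close z : `|cosine h z - dot (v j) (v (kappa z))| <= 2 * eps.
  apply: dot_perturbation => //; first exact/enorm_le1/normalize_le1.
    exact/enorm_le1.
  exact/vq/normalize_le1.
have gen_le : generalization_error D h <= mean p loss j.
  rewrite /generalization_error.
  (* A misclassified point has cosine at most [0], so its cell has a representative with inner
     product at most [2 * eps] with [v j]; there [phi] is [1]. *)
  apply: (@le_trans _ _ (\sum_(k | dot (v j) (v k) <= 2 * eps) p k)).
    have mh : measurable [set z : d.-tuple R * bool | dot h (signed_point z) <= 0].
      rewrite -[X in measurable X]setTI.
      have mdot : measurable_fun [set: d.-tuple R * bool]
          (fun z => dot h (signed_point z)).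
        under eq_fun do rewrite dotE.
        apply: measurable_sum => i; apply: measurable_funM => //.
        exact: measurable_signed_point.
      exact: (@measurable_fun_ler _ _ _ _ _ (cst 0) mdot _ _ [set true]).
    rewrite -lee_fin fineK ?fin_num_measure//.
    rewrite (sum_cell_prob D mkappa (fun k => dot (v j) (v k) <= 2 * eps)).
    apply: le_measure; rewrite ?inE//.
      by have [] := measure_fin_preimage D
        (fun k => dot (v j) (v k) <= 2 * eps) mkappa.
    move=> z /= /dot_normalize_le0; rewrite -/(cosine h z) => hz.
    by have := close z; rewrite ler_norml; lra.
  rewrite big_mkcond; apply: ler_sum => k _; case: ifPn => [hk|_].
    have h0 : 0 <= L * (2 * eps - dot (v j) (v k)).
      by rewrite mulr_ge0 ?subr_ge0// ltW.
    by rewrite /loss /phi clip_ge ?mulr1//; lra.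
  by rewrite mulr_ge0//; have /andP[] := phi01 (dot (v j) (v k)).
have good_j := le_trans (fmax_ge j0 _ j) good.
have dev_j : N%:R * mean p loss j - \sum_(n < N) loss (kappa (S n w)) j <= b.
  apply: le_trans good_j; rewrite /deviation le_eqVlt; apply/orP; left; apply/eqP.
  rewrite big_tuple fct_sumE.
  under [RHS]eq_bigr do rewrite tnth_mktuple.
  by rewrite /= sumrB sumr_const card_ord mulr_natl.
have emp_le : \sum_(n < N) loss (kappa (S n w)) j <=
    \sum_(n < N) clip (1 - L * cosine h (S n w)) + N%:R * e.
  have -> : N%:R * e = \sum_(n < N) e by rewrite sumr_const card_ord mulr_natl.
  rewrite -big_split/=.
  apply: ler_sum => n _; apply: le_clipD; first exact: ltW.
  have := close (S n w); rewrite ler_norml => /andP[_].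
  by move=> /(ler_wpM2l (ltW L0)); rewrite !mulrBr -Leps; lra.
apply: (le_trans gen_le); rewrite -/b -mulrDr -(ler_pM2l N0R).
by rewrite [leRHS]mulrDr mulVKf ?gt_eqF//; lra.
Qed.

End uniform_margin_bound.

(** * Rotation invariance of Gaussian families *)

Section lebesgue_affine.
Context {R : realType}.
Local Notation mu := (@lebesgue_measure R).

Lemma measurable_affine (a b : R) :
  measurable_fun [set: R] ((fun x => a * x + b) : _ -> measurableTypeR R).
Proof. by apply: measurable_funD => //; exact: measurable_funM. Qed.

(** The right-hand side is a scaled pushforward, hence a measure in [A], and half-open intervals
    determine Lebesgue measure. *)
Lemma lebesgue_measure_affine (a b : R) (A : set R) : a != 0 -> measurable A ->
  mu A = (`|a|%:E * mu ((fun x => a * x + b)%R @^-1` A))%E.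
Proof.
move=> a0 mA; pose f x := a * x + b : measurableTypeR R.
have [m mE] : exists m : {measure set (measurableTypeR R) -> \bar R},
    forall A, m A = mu (f @^-1` A).
  unshelve refine (ex_intro _ (pushforward mu f : {measure set _ -> \bar R}) _).
    exact: measurable_affine.
  by [].
rewrite -[X in (_ * X)%E](mE A).
rewrite -[RHS]/(mscale (NngNum (normr_ge0 a)) m A).
apply: lebesgue_measure_unique => //= _ [[u v]] _ <-.
rewrite /mscale/= mE.
have [a1|a1] := ltP 0 a.
  have -> : f @^-1` `]u, v] = `](u - b) / a, (v - b) / a]%classic.
    apply/seteqP; split => x; rewrite /f /= !in_itv/=;
      by rewrite ltr_pdivrMr// ler_pdivlMr// ltrBlDr lerBrDr mulrC.
  rewrite !lebesgue_measure_itv/= !lte_fin ltr_pM2r ?invr_gt0// ltrD2r.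
  case: ifPn => _; rewrite ?mule0// -!EFinB -EFinM gtr0_norm//.
  by congr EFin; field.
have {}a1 : a < 0 by rewrite lt_neqAle a0.
have -> : f @^-1` `]u, v] = `[(v - b) / a, (u - b) / a[%classic.
  apply/seteqP; split => x; rewrite /f /= !in_itv/=;
    by rewrite ler_ndivrMr// ltr_ndivlMr// ltrBlDr lerBrDr mulrC andbC.
rewrite !lebesgue_measure_itv/= !lte_fin ltr_nM2r ?invr_lt0// ltrD2r.
case: ifPn => _; rewrite ?mule0// -!EFinB -EFinM ltr0_norm//.
by congr EFin; field.
Qed.

Lemma ge0_integral_affine (a b : R) (f : R -> \bar R) : a != 0 ->
  measurable_fun [set: R] f -> (forall x, 0 <= f x)%E ->
  (\int[mu]_x f x = `|a|%:E * \int[mu]_x f (a * x + b)%R)%E.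
Proof.
move=> a0 mf f0; pose g x := a * x + b : measurableTypeR R.
have [m mE] : exists m : {measure set (measurableTypeR R) -> \bar R},
    m = pushforward mu g :> (set _ -> _).
  unshelve refine (ex_intro _ (pushforward mu g : {measure set _ -> \bar R}) _).
    exact: measurable_affine.
  by [].
transitivity (\int[mscale (NngNum (normr_ge0 a)) m]_x f x)%E.
  apply: eq_measure_integral => A mA _.
  apply: (etrans (lebesgue_measure_affine b a0 mA)).
  exact: (esym (congr1 (fun m' : set R -> \bar R => (`|a|%:E * m' A)%E) mE)).
rewrite ge0_integral_mscale//=; congr (_ * _)%E.
have -> : (\int[m]_x f x = \int[pushforward mu g]_x f x)%E by rewrite mE.
by rewrite ge0_integral_pushforward//; exact: measurable_affine.
Qed.

End lebesgue_affine.

Section normal_prob_facts.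
Context {R : realType} (sigma : R).
Hypothesis sigma0 : 0 < sigma.
Local Notation mu := (@lebesgue_measure R).
Local Notation pdf := (normal_pdf 0 sigma).
Local Notation gauss := (normal_prob 0 sigma).

(** Change of variables yields the Radon-Nikodym derivative, which equals the density almost
    everywhere because both have the same integral over every measurable set. *)
Lemma ge0_integral_normal_prob (f : R -> \bar R) :
  measurable_fun [set: R] f -> (forall x, 0 <= f x)%E ->
  (\int[gauss]_x f x = \int[mu]_x (f x * (pdf x)%:E))%E.
Proof.
move=> mf f0; have dom := @normal_prob_dominates R 0 sigma.
rewrite -(Radon_Nikodym_SigmaFinite.change_of_variables dom)//.
have mpdf : measurable_fun [set: R] (fun x => (pdf x)%:E).
  by apply/measurable_EFinP; exact: measurable_normal_pdf.
have mRN : measurable_fun [set: R] (Radon_Nikodym_SigmaFinite.f gauss mu).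
  exact: measurable_int (Radon_Nikodym_SigmaFinite.f_integrable dom).
apply: ge0_ae_eq_integral => //.
- exact: emeasurable_funM.
- exact: emeasurable_funM.
- by move=> x _; rewrite mule_ge0// Radon_Nikodym_SigmaFinite.f_ge0.
- by move=> x _; rewrite mule_ge0// lee_fin normal_pdf_ge0.
- apply: ae_eqe_mul2l; apply: integral_ae_eq => //.
  + exact: Radon_Nikodym_SigmaFinite.f_integrable.
  + by move=> A _ mA; rewrite -Radon_Nikodym_SigmaFinite.f_integral.
Qed.

End normal_prob_facts.

Section plane_reflection.
Context {R : realType}.
Local Notation mu := (@lebesgue_measure R).
Implicit Types H : R * R -> \bar R.

(** For [c ^+ 2 + s ^+ 2 = 1] this is an orthogonal symmetric matrix of determinant [-1]. If
    [(x0, y0)] is [r] times [(c, s)], its image is [(r, 0)]: this is how [triangularize] clears a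
    coordinate. *)
Definition reflection (c s : R) (z : R * R) : R * R :=
  (c * z.1 + s * z.2, s * z.1 - c * z.2).

Lemma measurable_reflection (c s : R) :
  measurable_fun [set: R * R] (reflection c s).
Proof.
apply: measurable_fun_pair => /=.
- by apply: measurable_funD; apply: measurable_funM.
- by apply: measurable_funB; apply: measurable_funM.
Qed.

(* The reflection is a composition of affine substitutions in one variable. *)
Lemma ge0_lebesgue2_reflection (c s : R) H : c ^+ 2 + s ^+ 2 = 1 ->
  measurable_fun [set: R * R] H -> (forall z, 0 <= H z)%E ->
  (\int[mu]_x \int[mu]_y H (reflection c s (x, y)) =
   \int[mu]_x \int[mu]_y H (x, y))%E.
Proof.
move=> cs mH H0.
have swap H' : measurable_fun [set: R * R] H' -> (forall z, 0 <= H' z)%E ->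
    (\int[mu]_x \int[mu]_y H' (x, y) = \int[mu]_y \int[mu]_x H' (x, y))%E.
  by move=> mH' H'0; exact: fubini_tonelli.
have mcomp (f g : R * R -> R) : measurable_fun setT f -> measurable_fun setT g ->
    measurable_fun [set: R * R] (fun z => H (f z, g z)).
  by move=> mf mg; apply: (measurableT_comp mH); exact: measurable_fun_pair.
have mfst : measurable_fun [set: R * R] (fun z => z.1) by exact: measurable_fst.
have msnd : measurable_fun [set: R * R] (fun z => z.2) by exact: measurable_snd.
have msec1 H' : measurable_fun [set: R * R] H' -> forall y,
    measurable_fun [set: R] (fun x => H' (x, y)).
  by move=> mH' y; apply: (measurableT_comp mH'); exact: measurable_fun_pair.
have msec2 H' : measurable_fun [set: R * R] H' -> forall x,
    measurable_fun [set: R] (fun y => H' (x, y)).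
  by move=> mH' x; apply: (measurableT_comp mH'); exact: measurable_fun_pair.
have mHr : measurable_fun [set: R * R] (H \o reflection c s).
  exact: (measurableT_comp mH (measurable_reflection c s)).
(* The general substitutions divide by [c]; for [c = 0] the map is an exchange of the coordinates up
   to a common sign. *)
have [c0|c0] := eqVneq c 0.
  have ss : s * s = 1 by rewrite -cs c0 expr0n add0r expr2.
  have s0 : s != 0 by apply: contra_eq_neq ss => ->; rewrite mul0r eq_sym oner_eq0.
  have s1 : `|s| = 1.
    by apply/eqP; rewrite -sqrp_eq1// real_normK ?num_real// expr2 ss.
  have sE (t : R) : s * (s * t + 0) = t by rewrite addr0 mulrA ss mul1r.
  pose H1 (z : R * R) := H (s * z.2, s * z.1).
  pose H2 (z : R * R) := H (z.2, s * z.1).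
  have mH1 : measurable_fun [set: R * R] H1 by apply: mcomp; exact: measurable_funM.
  have mH2 : measurable_fun [set: R * R] H2 by apply: mcomp => //;
    exact: measurable_funM.
  have step1 (x : R) : (\int[mu]_y H (reflection c s (x, y)) = \int[mu]_y H2 (x, y))%E.
    transitivity (\int[mu]_y H1 (x, y))%E.
      apply: eq_integral => t _; have e : reflection c s (x, t) = (s * t, s * x).
        by rewrite /reflection /= c0 !mul0r add0r subr0.
      exact: (congr1 H e).
    rewrite (ge0_integral_affine 0 s0 (msec2 _ mH1 x)); last by move=> ?; exact: H0.
    rewrite s1 mul1e; apply: eq_integral => t _.
    exact: (congr1 (fun t => H (t, s * x)) (sE t)).
  have step2 (y : R) : (\int[mu]_x H2 (x, y) = \int[mu]_x H (y, x))%E.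
    rewrite (ge0_integral_affine 0 s0 (msec1 _ mH2 y)); last by move=> ?; exact: H0.
    rewrite s1 mul1e; apply: eq_integral => t _.
    exact: (congr1 (fun t => H (y, t)) (sE t)).
  transitivity (\int[mu]_x \int[mu]_y H2 (x, y))%E.
    by apply: eq_integral => x _; exact: step1.
  apply: (etrans (swap _ mH2 (fun z => H0 _))).
  by apply: eq_integral => y _; exact: step2.
(* The first substitution eliminates [y] from the first coordinate; the second one,
   [y := - c * t + s * x], restores the second coordinate. Their Jacobians cancel in absolute
   value. *)
have refl1 (x y : R) :
    reflection c s (c^-1 * x + - (s / c) * y, y) = (x, (s * x - y) / c).
  congr (_, _) => /=; first by field.
  transitivity ((s * x - (c ^+ 2 + s ^+ 2) * y) / c); first by field.
  by rewrite cs mul1r.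
pose H1 (z : R * R) := H (z.1, (s * z.1 - z.2) / c).
have step1 (y : R) : (\int[mu]_x H (reflection c s (x, y)) =
    `|c^-1|%:E * \int[mu]_x H1 (x, y))%E.
  rewrite (ge0_integral_affine (- (s / c) * y) (invr_neq0 c0) (msec1 _ mHr y));
    last by move=> ?; exact: H0.
  by congr (_ * _)%E; apply: eq_integral => x _; exact: (congr1 H (refl1 x y)).
have mH1 : measurable_fun [set: R * R] H1.
  apply: mcomp => //; apply: measurable_funM => //; apply: measurable_funB => //.
  exact: measurable_funM.
have step2 (x : R) : (\int[mu]_y H1 (x, y) = `|c|%:E * \int[mu]_y H (x, y))%E.
  have nc0 : - c != 0 by rewrite oppr_eq0.
  rewrite (ge0_integral_affine (s * x) nc0 (msec2 _ mH1 x)); last by move=> ?;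
    exact: H0.
  rewrite normrN.
  congr (_ * _)%E; apply: eq_integral => t _.
  suff e : (s * x - (- c * t + s * x)) / c = t :> R by exact: (congr1 (fun t => H (x,
    t)) e).
  by field.
rewrite (_ : (\int[mu]_x _)%E = (\int[mu]_y \int[mu]_x H (reflection c s (x, y)))%E);
  last first.
  by apply: (swap _ mHr) => z; exact: H0.
under eq_integral do rewrite step1.
have mF1 : measurable_fun [set: R] (fun y => \int[mu]_x H1 (x, y))%E.
  by apply: measurable_fun_fubini_tonelli_G => // z; exact: H0.
have mF2 : measurable_fun [set: R] (fun x => \int[mu]_y H (x, y))%E.
  by apply: measurable_fun_fubini_tonelli_F => // z; exact: H0.
rewrite ge0_integralZl//; last by move=> *; apply: integral_ge0 => *; exact: H0.
rewrite -(swap _ mH1)//; last by move=> z; exact: H0.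
under eq_integral do rewrite step2.
rewrite ge0_integralZl//; last by move=> *; apply: integral_ge0 => *; exact: H0.
by rewrite muleA -EFinM -normrM mulVf// normr1 mul1e.
Qed.

End plane_reflection.

Section normal_plane.
Context {R : realType} (sigma : R).
Hypothesis sigma0 : 0 < sigma.
Local Notation mu := (@lebesgue_measure R).
Local Notation pdf := (normal_pdf 0 sigma).
Local Notation gauss := (normal_prob 0 sigma).

Let mpdf : measurable_fun [set: R] (fun x => (pdf x)%:E).
Proof. by apply/measurable_EFinP; exact: measurable_normal_pdf. Qed.

Let pdf_ge0 x : (0 <= (pdf x)%:E)%E.
Proof. by rewrite lee_fin normal_pdf_ge0. Qed.

Lemma normal_prodE (E : set (R * R)) : measurable E ->
  ((gauss \x gauss) E = \int[mu]_x \int[mu]_y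
    ((\1_E (x, y))%:E * ((pdf x)%:E * (pdf y)%:E)))%E.
Proof.
move=> mE.
have mI : measurable_fun [set: R * R] (fun z => (\1_E z)%:E : \bar R).
  by apply/measurable_EFinP; exact: measurable_indic.
have mf : measurable_fun [set: R * R] (fun z => ((\1_E z)%:E * (pdf z.2)%:E)%E).
  apply: emeasurable_funM => //.
  exact: (measurableT_comp mpdf measurable_snd).
have f0 z : (0 <= (\1_E z)%:E * (pdf z.2)%:E :> \bar R)%E.
  by rewrite mule_ge0// lee_fin.
have sec x : (gauss (xsection E x) = \int[mu]_y ((\1_E (x, y))%:E * (pdf y)%:E))%E.
  rewrite /normal_prob integral_mkcond; apply: eq_integral => y _.
  rewrite patchE indicE mem_xsection; case: ifPn => _; first by rewrite mul1e.
  by rewrite mul0e.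
pose F x := (\int[mu]_y ((\1_E (x, y))%:E * (pdf y)%:E))%E.
have mF : measurable_fun [set: R] F.
  exact: (@measurable_fun_fubini_tonelli_F _ _ _ _ _ mu _ mf f0).
have F0 x : (0 <= F x)%E by apply: integral_ge0 => y _; exact: (f0 (x, y)).
transitivity (\int[gauss]_x F x)%E; first by apply: eq_integral => x _; exact: sec.
rewrite ge0_integral_normal_prob//; rewrite /F.
apply: eq_integral => x _.
rewrite muleC -ge0_integralZl//.
- by apply: eq_integral => y _; rewrite muleCA.
- by apply: (measurableT_comp mf); exact: measurable_fun_pair.
Qed.

Lemma normal_pdf_reflection (c s x y : R) : c ^+ 2 + s ^+ 2 = 1 ->
  pdf (c * x + s * y) * pdf (s * x - c * y) = pdf x * pdf y.
Proof.
move=> cs; rewrite normal_pdfE ?gt_eqF//.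
rewrite mulrACA [RHS]mulrACA; congr (_ * _); rewrite /normal_fun -!expRD.
congr expR; rewrite !subr0 -!mulrDl; congr (_ / _); rewrite -!opprD; congr (- _).
by transitivity ((c ^+ 2 + s ^+ 2) * (x ^+ 2 + y ^+ 2)); [ring|rewrite cs mul1r].
Qed.

Lemma normal_prod_reflection (c s : R) (E : set (R * R)) :
  c ^+ 2 + s ^+ 2 = 1 -> measurable E ->
  ((gauss \x gauss) (reflection c s @^-1` E) = (gauss \x gauss) E)%E.
Proof.
move=> cs mE.
have mE' : measurable (reflection c s @^-1` E).
  by rewrite -[X in measurable X]setTI; exact: measurable_reflection.
apply: (etrans (normal_prodE mE')); apply/esym/(etrans (normal_prodE mE))/esym.
pose H (z : R * R) := ((\1_E z)%:E * ((pdf z.1)%:E * (pdf z.2)%:E) : \bar R)%E.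
rewrite -[RHS]/(\int[mu]_x \int[mu]_y H (x, y))%E.
rewrite -(ge0_lebesgue2_reflection cs).
- apply: eq_integral => x _; apply: eq_integral => y _.
  transitivity ((\1_E (reflection c s (x, y)))%:E * (pdf x * pdf y)%R%:E)%E.
    by rewrite EFinM.
  by rewrite -(normal_pdf_reflection x y cs) EFinM.
- apply: emeasurable_funM; first by apply/measurable_EFinP; exact: measurable_indic.
  apply: emeasurable_funM.
    exact: (measurableT_comp mpdf measurable_fst).
  exact: (measurableT_comp mpdf measurable_snd).
- by move=> z; rewrite /H !mule_ge0// lee_fin.
Qed.

(** The reflection with [c = -1] and [s = 0] negates the first coordinate only; invariance is
    applied to the cylinder over [A]. *)
Lemma normal_probN (A : set R) : measurable A -> gauss (-%R @^-1` A) = gauss A.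
Proof.
move=> mA; have cs : (-1) ^+ 2 + 0 ^+ 2 = 1 :> R by rewrite sqrrN expr1n expr0n addr0.
have mAT : measurable (A `*` [set: R]) by exact: measurableX.
have := normal_prod_reflection cs mAT.
have -> : reflection (-1) 0 @^-1` (A `*` [set: R]) = (-%R @^-1` A) `*` [set: R].
  by apply/seteqP; split => z; rewrite /reflection /= mul0r addr0 mulN1r.
have mNA : measurable (-%R @^-1` A).
  by rewrite -[X in measurable X]setTI; exact: oppr_measurable.
have prodT (B : set R) : measurable B ->
    ((gauss \x gauss) (B `*` [set: R]) = gauss B)%E.
  move=> mB; have := @product_measure1E _ _ _ _ R gauss gauss B [set: R] mB measurableT.
  by rewrite [X in (_ * X)%E](probability_setT gauss) mule1.
by rewrite !prodT.
Qed.

End normal_plane.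

(** * Tails and second moment of the normal law *)

Section normal_tail.
Context {R : realType} (sigma : R).
Hypothesis sigma0 : 0 < sigma.
Local Notation mu := (@lebesgue_measure R).
Local Notation gauss := (normal_prob 0 sigma).

Lemma normal_prob_itv_le (a b : R) : a <= b ->
  (gauss `]a, b[ <= (normal_peak sigma * (b - a))%:E)%E.
Proof.
move=> ab; rewrite /normal_prob.
apply: (@le_trans _ _ (\int[mu]_(x in `]a, b[) (normal_peak sigma)%:E)%E).
  apply: ge0_le_integral => //.
  - by move=> x _; rewrite lee_fin normal_pdf_ge0.
  - by apply/measurable_funTS/measurable_EFinP; exact: measurable_normal_pdf.
  - by move=> x _; rewrite lee_fin normal_pdf_ub// gt_eqF.
rewrite integral_cst//= lebesgue_measure_itv/= lte_fin EFinM.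
by case: ltP => // _; rewrite mule0 mule_ge0// lee_fin ?normal_peak_ge0 ?subr_ge0.
Qed.

(** Two tails of equal mass and the interval from [- t] to [t] (empty for [t <= 0]) cover the line,
    and the density is at most its peak [1 / (sigma * sqrt (2 pi))]. This peak is the origin of
    [2 / pi] in the final constant. *)
Lemma normal_prob_tail (t : R) :
  1 <= 2 * fine (gauss `]-oo, (- t)%R]) +
       normal_peak sigma * (2 * Num.max 0 t).
Proof.
have sym : gauss `[t, +oo[ = gauss `]-oo, (- t)%R].
  rewrite -normal_probN//; congr (gauss _).
  by apply/seteqP; split => x /=; rewrite !in_itv/= ?andbT lerNr.
have mid : (gauss `](- t)%R, t[ <= (normal_peak sigma * (2 * Num.max 0 t))%:E)%E.
  have [t0|t0] := leP t 0; last first.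
    have tt : - t <= t by lra.
    apply: (le_trans (normal_prob_itv_le tt)).
    by rewrite (_ : t - - t = 2 * t)//; ring.
    rewrite (_ : [set` _] = set0) ?measure0 ?lee_fin ?mulr0//.
    by apply/seteqP; split => // x /=; rewrite in_itv/= => /andP[]; lra.
have cover : (1 <= gauss `]-oo, (- t)%R] + gauss `](- t)%R, t[ + gauss `[t, +oo[)%E.
  rewrite -(probability_setT gauss).
  apply: (@le_trans _ _ (gauss ((`]-oo, (- t)%R] `|` `](- t)%R, t[) `|` `[t, +oo[))).
    apply: le_measure; rewrite ?inE//; first by do ?apply: measurableU.
    move=> x _ /=; rewrite !in_itv/= andbT.
    have [h1|h1] := leP x (- t); first by left; left.
    by have [h2|h2] := ltP x t; [left; right|right].
  apply: (le_trans (measureU2 _ _ _)) => //; first exact: measurableU.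
  by rewrite leeD2r// measureU2.
rewrite -lee_fin EFinD; apply: (le_trans cover).
rewrite sym addeAC; apply: leeD => //.
by rewrite mulr2n mulrDl mul1r EFinD fineK// fin_num_measure.
Qed.

Lemma normal_peakE (s : R) : 0 < s ->
  normal_peak s = (s * Num.sqrt (pi *+ 2))^-1.
Proof.
move=> s0; rewrite /normal_peak -mulrnAr sqrtrM ?sqr_ge0//.
by rewrite sqrtr_sqr gtr0_norm.
Qed.

(* Integrate 1 + e x^2 <= exp (e x^2), whose right-hand side turns the normal
   density of deviation sigma into that of deviation tau, and let tau tend to
   sigma. *)
Lemma normal_second_moment :
  (\int[gauss]_x (x ^+ 2)%:E <= (sigma ^+ 2)%:E)%E.
Proof.
have msq : measurable_fun [set: R] (fun x : R => (x ^+ 2)%:E).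
  by apply/measurable_EFinP; exact: measurable_funX.
have key (tau : R) : sigma < tau ->
    (\int[gauss]_x (x ^+ 2)%:E <= (tau ^+ 2)%:E)%E.
  move=> st; have tau0 : 0 < tau by exact: lt_trans st.
  (* Half the difference of [1 / sigma ^+ 2] and [1 / tau ^+ 2]. *)
  pose e := (tau ^+ 2 - sigma ^+ 2) / (2 * sigma ^+ 2 * tau ^+ 2).
  have e0 : 0 < e.
    apply: divr_gt0; last by rewrite !mulr_gt0 ?exprn_gt0.
    rewrite subr_sqr; apply: mulr_gt0; last exact: addr_gt0.
    by rewrite subr_gt0.
  have mexp : measurable_fun [set: R] (fun x : R => (expR (e * x ^+ 2))%:E).
    apply/measurable_EFinP; apply: measurableT_comp => //.
    by apply: measurable_funM => //; exact: measurable_funX.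
  have laplace : (\int[gauss]_x (expR (e * x ^+ 2))%:E = (tau / sigma)%:E)%E.
    rewrite ge0_integral_normal_prob//.
    transitivity (\int[mu]_x ((tau / sigma)%:E * (normal_pdf 0 tau x)%:E))%E.
      apply: eq_integral => x _; rewrite -!EFinM; congr EFin.
      rewrite !normal_pdfE ?gt_eqF//.
      have -> : normal_peak sigma = tau / sigma * normal_peak tau :> R.
        rewrite !normal_peakE//.
        have p0 : Num.sqrt (pi *+ 2) != 0 :> R by rewrite gt_eqF// sqrtr_gt0
          mulrn_wgt0// pi_gt0.
        by field; rewrite p0 !gt_eqF.
      rewrite mulrCA -!mulrA; congr (_ * (_ * (_ * _))).
      rewrite /normal_fun -expRD !subr0; congr expR; rewrite /e.
      by field; rewrite !gt_eqF.
    rewrite ge0_integralZl//.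
    - by rewrite integral_normal_pdf mule1.
    - by apply/measurable_EFinP; exact: measurable_normal_pdf.
    - by move=> x _; rewrite lee_fin normal_pdf_ge0.
    - by rewrite lee_fin divr_ge0// ltW.
  have : (1 + e%:E * \int[gauss]_x (x ^+ 2)%:E <= (tau / sigma)%:E)%E.
    rewrite -laplace -ge0_integralZl//; last 2 first.
    - by move=> x _; rewrite lee_fin sqr_ge0.
    - by rewrite lee_fin ltW.
    have E1 : (\int[gauss]_(x in [set: R]) (cst 1 x) = 1 :> \bar R)%E.
      by rewrite integral_cst// mul1e; exact: probability_setT.
    have h1 (x : R) : (0 <= e%:E * (x ^+ 2)%:E)%E.
      by rewrite mule_ge0// lee_fin ?sqr_ge0// ltW.
    have h2 (x : R) : (cst 1 x + e%:E * (x ^+ 2)%:E <= (expR (e * x ^+ 2))%:E)%E.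
      by rewrite /= -EFinM -EFinD lee_fin expR_ge1Dx.
    rewrite -[X in (X + _)%E]E1 -ge0_integralD//.
    - apply: ge0_le_integral => //.
      + by move=> x _; rewrite adde_ge0// h1.
      + by apply: emeasurable_funD => //; apply: emeasurable_funM.
    - exact: emeasurable_funM.
  have I0 : (0 <= \int[gauss]_x (x ^+ 2)%:E)%E.
    by apply: integral_ge0 => x _; rewrite lee_fin sqr_ge0.
  case: (\int[gauss]_x (x ^+ 2)%:E)%E I0 => [r r0| |//].
    rewrite -EFinM -EFinD !lee_fin => her.
    have her' : e * r <= (tau - sigma) / sigma.
      by rewrite mulrBl divff ?gt_eqF// lerBrDl.
    have eE : e * tau ^+ 2 = (tau - sigma) / sigma * ((tau + sigma) / (2 * sigma)).
      by rewrite /e; field; rewrite !gt_eqF.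
    rewrite -(ler_pM2l e0); apply: (le_trans her'); rewrite eE ler_peMr//.
      by rewrite divr_ge0 ?subr_ge0 ?ltW.
    by rewrite ler_pdivlMr ?mulr_gt0//; have := ltW st; lra.
  by move=> _; rewrite gt0_muley ?lte_fin// addey.
have I0 : (0 <= \int[gauss]_x (x ^+ 2)%:E)%E.
  by apply: integral_ge0 => x _; rewrite lee_fin sqr_ge0.
case: (\int[gauss]_x (x ^+ 2)%:E)%E key I0 => [r key r0| /(_ (sigma + 1))|//].
  rewrite lee_fin leNgt; apply/negP => rs.
  (* If the moment [r] exceeded [sigma ^+ 2], then [key] at [tau ^+ 2 = m], strictly between the
     two, would give [r <= m]. *)
  pose m := (r + sigma ^+ 2) / 2.
  have s2 : 0 < sigma ^+ 2 by rewrite exprn_gt0.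
  have m0 : 0 <= m by rewrite divr_ge0// addr_ge0 ?sqr_ge0.
  have sm : sigma < Num.sqrt m.
    by rewrite -[ltLHS]gtr0_norm// -sqrtr_sqr ltr_sqrt; rewrite /m; lra.
  by have := key _ sm; rewrite lee_fin sqr_sqrtr// /m; lra.
by rewrite ltrDl ltr01 => /(_ isT).
Qed.

End normal_tail.

(** * Orthogonal changes of coordinates in i.i.d. Gaussian families *)

Section iid_families.
Context {dO dT : measure_display} {O : measurableType dO}
  {T : measurableType dT} {R : realType} {P : probability O R}.

Definition rv_of (f : O -> T) (mf : measurable_fun [set: O] f) : {RV P >-> T} :=
  HB.pack f (isMeasurableFun.Build _ _ _ _ f mf).

(** Factors equal to the whole space drop out, so boxes over the full index set encode both the
    independence of subfamilies and the common law. *)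
Lemma iid_boxP {I : finType} (X : I -> {RV P >-> T}) (mu : set T -> \bar R) :
  mu [set: T] = 1%E -> iid X mu <-> forall A : I -> set T, (forall i, measurable (A i))
    ->
    P (\bigcap_i X i @^-1` A i) = (\prod_i mu (A i))%E.
Proof.
move=> muT; split=> [[ind law] A mA|box].
  have -> : \bigcap_i X i @^-1` A i = \bigcap_(i in [set` [set: I]%SET]) X i @^-1` A i.
    by apply/seteqP; split => w h i _; apply: h; rewrite /= ?inE.
  apply: (etrans (ind _ _ mA)).
  by apply: eq_big => [i|i _]; [rewrite inE|exact: law].
have sub (J : {set I}) (A : I -> set T) : (forall i, measurable (A i)) ->
    P (\bigcap_(i in [set` J]) X i @^-1` A i) = (\prod_(i in J) mu (A i))%E.
  move=> mA; pose B i := if i \in J then A i else [set: T].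
  have mB i : measurable (B i) by rewrite /B; case: ifP.
  have -> : \bigcap_(i in [set` J]) X i @^-1` A i = \bigcap_i X i @^-1` B i.
    apply/seteqP; split => w h i /= iJ; have := h i; rewrite /B /=.
      by case: ifP => // + /(_ isT).
    by rewrite ifT//; exact.
  rewrite box// [RHS]big_mkcond/=; apply: eq_bigr => i _.
  by rewrite /B; case: ifP.
have law i (A : set T) : measurable A -> P (X i @^-1` A) = mu A.
  move=> mA; have := sub [set i]%SET (fun=> A) (fun=> mA).
  rewrite big_set1 => <-; congr (P _).
  apply/seteqP; split => w /= h; first by move=> j; rewrite /= inE => /eqP ->.
  by apply: (h i); rewrite /= inE.
split=> // J A mA; rewrite sub//; apply: eq_bigr => i _.
by rewrite law.
Qed.

Lemma iid_inj {I I' : finType} (f : I' -> I) (X : I -> {RV P >-> T})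
    (mu : set T -> \bar R) : injective f -> iid X mu -> iid (X \o f) mu.
Proof.
move=> injf [ind law]; split=> [J A mA|i A mA]; last exact: law.
pose B i := if [pick i' | f i' == i] is Some i' then A i' else [set: T].
have Bf i' : B (f i') = A i'.
  rewrite /B; case: pickP => [j /eqP/injf ->//|/(_ i')].
  by rewrite eqxx.
have mB i : measurable (B i) by rewrite /B; case: pickP.
have := ind (f @: J)%SET B mB.
rewrite big_imset/=; last by move=> ? ? _ _; exact: injf.
under [in RHS]eq_bigr do rewrite Bf.
move=> <-; congr (P _); apply/seteqP; split => w h i /= iJ.
- by move/imsetP : iJ => [j jJ ->]; rewrite Bf; exact: h.
- by rewrite -Bf; apply: h => /=; exact: imset_f.
Qed.

End iid_families.

Section givens_rotation.
Context {dO : measure_display} {O : measurableType dO} {R : realType}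
  {P : probability O R} {I : finType}.
Variables (sigma : R) (G : I -> {RV P >-> R}).
Hypotheses (sigma0 : 0 < sigma) (G_iid : iid G (normal_prob 0 sigma)).
Local Notation gauss := (normal_prob 0 sigma).

Lemma product_normal_mscale (p : {nonneg R}) (E : set (R * R)) : measurable E ->
  ((gauss \x mscale p gauss) E = p%:num%:E * (gauss \x gauss) E)%E.
Proof.
move=> mE; rewrite -[RHS]/(mscale p (gauss \x gauss)%E E).
apply: product_measure_unique => // A B mA mB.
rewrite /mscale [RHS]muleCA; congr (_ * _)%E.
exact: product_measure1E.
Qed.

(** By [iid_boxP] only boxes matter. With the events on all other indices fixed, the pair
    [(G a, G b)] follows a multiple of the Gaussian measure of the plane, which the reflection
    preserves. *)
Lemma givens_iid (a b : I) (c s : R) : a != b -> c ^+ 2 + s ^+ 2 = 1 ->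
  exists G' : I -> {RV P >-> R},
    [/\ iid G' gauss, forall w, G' a w = c * G a w + s * G b w,
        forall w, G' b w = s * G a w - c * G b w &
        forall i w, i != a -> i != b -> G' i w = G i w].
Proof.
move=> ab cs; have ba : b != a by rewrite eq_sym.
pose pair w := (G a w, G b w).
have mpair : measurable_fun [set: O] pair by exact: measurable_fun_pair.
pose f i w := if i == a then (reflection c s (pair w)).1
  else if i == b then (reflection c s (pair w)).2 else G i w.
have mf i : measurable_fun [set: O] (f i).
  rewrite /f; case: eqP => _.
    exact: (measurableT_comp measurable_fst
      (measurableT_comp (measurable_reflection c s) mpair)).
  case: eqP => _ //.
  exact: (measurableT_comp measurable_snd
    (measurableT_comp (measurable_reflection c s) mpair)).
exists (fun i => rv_of (mf i)); split; last 3 first.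
- by move=> w; rewrite /rv_of /= /f eqxx.
- by move=> w; rewrite /rv_of /= /f (negbTE ba) eqxx.
- by move=> i w /negbTE ia /negbTE ib; rewrite /rv_of /= /f ia ib.
have gT : gauss [set: R] = 1%E by exact: probability_setT.
apply: (iid_boxP _ gT).2 => A mA.
have box := (iid_boxP G gT).1 G_iid.
pose others : pred I := [pred i | (i != a) && (i != b)].
pose F := \bigcap_(i in [set` others]) G i @^-1` A i.
have mG i B : measurable B -> measurable (G i @^-1` B).
  by move=> mB; rewrite -[X in measurable X]setTI; exact: measurable_funP.
have mF : measurable F by apply: fin_bigcap_measurable => // i _; exact: mG.
have fin i : gauss (A i) \is a fin_num.
  by apply: (fin_num_measure gauss); exact: mA.
pose p : R := \prod_(i | others i) fine (gauss (A i)).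
have p0 : 0 <= p by apply: prodr_ge0 => i _; rewrite fine_ge0.
have pE : p%:E = (\prod_(i | others i) gauss (A i))%E.
  by rewrite /p -prodEFin; apply: eq_bigr => i _; rewrite fineK.
have prod3 (B C : set R) (A' : I -> set R) : A' a = B -> A' b = C ->
    (forall i, others i -> A' i = A i) ->
    (\prod_i gauss (A' i) = gauss B * (p%:E * gauss C))%E.
  move=> Aa Ab Ao; rewrite (bigD1 a)//= (bigD1 b)//= Aa Ab pE; congr (_ * _)%E.
  by rewrite muleC; congr (_ * _)%E; apply: eq_bigr => i io; rewrite Ao.
(* The law of the pair under [P] restricted to [F]; [mprod] identifies it from its values on
   rectangles. *)
have [m mE] : exists m : {measure set (measurableTypeR R * measurableTypeR R)%type ->
  \bar R},
    forall E, m E = P ((pair @^-1` E) `&` F).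
  pose pairT : O -> (measurableTypeR R * measurableTypeR R)%type := pair.
  unshelve refine (ex_intro _
    (pushforward (mrestr P mF) pairT : {measure set _ -> \bar R}) _).
    exact: mpair.
  by [].
have mprod E : measurable E -> (m E = p%:E * (gauss \x gauss) E)%E.
  move=> mE'; rewrite -[p]/(NngNum p0)%:num -product_normal_mscale//.
  apply/esym/product_measure_unique => // B C mB mC.
  pose A' i := if i == a then B else if i == b then C else A i.
  rewrite mE -(prod3 B C A'); last 3 first.
  - by rewrite /A' eqxx.
  - by rewrite /A' (negbTE ba) eqxx.
  - by move=> i /andP[/negbTE ia /negbTE ib]; rewrite /A' ia ib.
  rewrite -box => [|i]; last by rewrite /A'; case: ifP => // _; case: ifP.
  congr (P _); apply/seteqP; split => w.
    move=> [[/= Bw Cw] Fw] i _; rewrite /A' /=.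
    case: eqP => [->//|/eqP ia]; case: eqP => [->//|/eqP ib].
    by apply: (Fw i); exact/andP.
  move=> h; split; first split => /=.
  - by have := h a Logic.I; rewrite /A' /= eqxx.
  - by have := h b Logic.I; rewrite /A' /= (negbTE ba) eqxx.
  - by move=> i /= /andP[/negbTE ia /negbTE ib]; have := h i Logic.I;
    rewrite /A' /= ia ib.
have mE' : measurable (reflection c s @^-1` (A a `*` A b)).
  rewrite -[X in measurable X]setTI; apply: measurable_reflection => //.
  exact: measurableX.
transitivity (m (reflection c s @^-1` (A a `*` A b))).
  rewrite mE; congr (P _); apply/seteqP; split => w.
    move=> h; split; first split.
    - by have := h a Logic.I; rewrite /rv_of /= /f eqxx.
    - by have := h b Logic.I; rewrite /rv_of /= /f (negbTE ba) eqxx.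
    - by move=> i /= /andP[/negbTE ia /negbTE ib]; have := h i Logic.I;
      rewrite /rv_of /= /f ia ib.
  move=> [[/= h1 h2] Fw] i _; rewrite /rv_of /= /f.
  case: eqP => [->//|/eqP ia]; case: eqP => [->//|/eqP ib].
  by apply: (Fw i); exact/andP.
rewrite mprod// normal_prod_reflection//; last exact: measurableX.
rewrite (prod3 (A a) (A b))// muleCA; congr (_ * _)%E.
exact: (@product_measure1E _ _ _ _ R gauss gauss (A a) (A b) (mA a) (mA b)).
Qed.

End givens_rotation.

Section column_reflection.
Context {dQ : measure_display} {Q : measurableType dQ} {R : realType}
  {PQ : probability Q R} {k d : nat}.
Variables (sigma : R).
Hypothesis sigma0 : 0 < sigma.
Local Notation gauss := (normal_prob 0 sigma).
Implicit Types G : 'I_k * 'I_d -> {RV PQ >-> R}.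

Definition reflect_coord (a b : 'I_d) (c s : R) (x : 'cV[R]_d) : 'cV[R]_d :=
  \col_j (if j == a then c * x a 0 + s * x b 0
          else if j == b then s * x a 0 - c * x b 0 else x j 0).

Lemma sum_two_split (a b : 'I_d) (F : 'I_d -> R) : a != b ->
  \sum_j F j = F a + F b + \sum_(j | (j != a) && (j != b)) F j.
Proof.
move=> ab; rewrite (bigD1 a)//= (bigD1 b)//= ?addrA// eq_sym//.
Qed.

Lemma reflect_coord_pairing (a b : 'I_d) (c s : R) (x y : 'cV[R]_d) : a != b ->
  c ^+ 2 + s ^+ 2 = 1 ->
  \sum_j reflect_coord a b c s x j 0 * reflect_coord a b c s y j 0 =
  \sum_j x j 0 * y j 0.
Proof.
move=> ab cs; rewrite !(sum_two_split _ ab); congr (_ + _).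
  rewrite !mxE eqxx (negbTE (_ : b != a)) 1?eq_sym// eqxx.
  transitivity ((c ^+ 2 + s ^+ 2) * (x a 0 * y a 0 + x b 0 * y b 0)); first by ring.
  by rewrite cs mul1r.
by apply: eq_bigr => j /andP[/negbTE ja /negbTE jb]; rewrite !mxE ja jb.
Qed.

(** Reflecting both a row of the matrix and [x] preserves their pairing. The rows are replaced one
    at a time, each by [givens_iid]; [r] counts those already done. *)
Lemma column_reflection G (a b : 'I_d) (c s : R) : a != b ->
  c ^+ 2 + s ^+ 2 = 1 -> iid G gauss ->
  exists2 G' : 'I_k * 'I_d -> {RV PQ >-> R}, iid G' gauss & forall w (x : 'cV[R]_d),
    matrix_of G w *m x = matrix_of G' w *m reflect_coord a b c s x.
Proof.
move=> ab cs G_iid.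
suff [G' G'_iid G'E] : exists2 G' : 'I_k * 'I_d -> {RV PQ >-> R}, iid G' gauss & forall
  (i : 'I_k) w,
    (\col_j G' (i, j) w) = reflect_coord a b c s (\col_j G (i, j) w).
  exists G' => // w x; apply/colP => i; rewrite !mxE.
  under eq_bigr do rewrite mxE.
  under [RHS]eq_bigr do rewrite mxE.
  have := reflect_coord_pairing (\col_j G (i, j) w) x ab cs.
  rewrite -G'E => e; apply: (etrans (esym _)).
    by apply: (etrans e); apply: eq_bigr => j _; rewrite mxE.
  by apply: eq_bigr => j _; rewrite mxE.
suff step r : (r <= k)%N -> exists2 G' : 'I_k * 'I_d -> {RV PQ >-> R}, iid G' gauss &
  forall (i : 'I_k) w,
    (\col_j G' (i, j) w) = if (i < r)%N then reflect_coord a b c s (\col_j G (i, j) w)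
      else \col_j G (i, j) w.
  have [G' G'_iid G'E] := step k (leqnn k).
  by exists G' => // i w; rewrite G'E ltn_ord.
elim: r => [_|r IH rk]; first by exists G.
have [G1 G1_iid G1E] := IH (ltnW rk).
pose r' := Ordinal rk.
have ab' : (r', a) != (r', b) by rewrite xpair_eqE eqxx.
have [G2 [G2_iid G2a G2b G2o]] := givens_iid sigma0 G1_iid ab' cs.
exists G2 => // i w.
have [ir|ir] := eqVneq i r'.
  rewrite ir ltnSn; have := G1E r' w; rewrite ltnn => G1r.
  have e j : G1 (r', j) w = G (r', j) w by move/colP/(_ j) : (G1r); rewrite !mxE.
  apply/colP => j; rewrite !mxE.
  case: eqP => [->|/eqP ja]; first by rewrite G2a !e.
  case: eqP => [->|/eqP jb]; first by rewrite G2b !e.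
  by rewrite G2o ?xpair_eqE ?eqxx// e.
have -> : (i < r.+1)%N = (i < r)%N.
  by rewrite ltnS leq_eqVlt (negbTE (_ : i != r :> nat)).
rewrite -G1E; apply/colP => j; rewrite !mxE.
by rewrite G2o// xpair_eqE (negbTE ir).
Qed.

(** Givens elimination: the coordinates of [v] after [a] are reflected into coordinate [a] one by
    one. Only coordinates from [a] on are mixed, so vectors vanishing there keep doing so, and a
    second call does not spoil the result of a first one at a smaller index. *)
Lemma triangularize G (a : 'I_d) (v : 'cV[R]_d) : iid G gauss ->
  exists (G' : 'I_k * 'I_d -> {RV PQ >-> R}) (T : 'cV[R]_d -> 'cV[R]_d),
    [/\ iid G' gauss,
        forall w x, matrix_of G w *m x = matrix_of G' w *m T x,
        forall x y, dot (T x) (T y) = dot x y,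
        forall x : 'cV[R]_d, (forall j : 'I_d, (a <= j)%N -> x j 0 = 0) ->
          forall j : 'I_d, (a <= j)%N -> T x j 0 = 0 &
        forall j : 'I_d, (a < j)%N -> T v j 0 = 0].
Proof.
move=> G_iid.
suff step m : (m <= d)%N -> exists (G' : 'I_k * 'I_d -> {RV PQ >-> R})
    (T : 'cV[R]_d -> 'cV[R]_d),
    [/\ iid G' gauss,
        forall w x, matrix_of G w *m x = matrix_of G' w *m T x,
        forall x y, dot (T x) (T y) = dot x y,
        forall x : 'cV[R]_d, (forall j : 'I_d, (a <= j)%N -> x j 0 = 0) ->
          forall j : 'I_d, (a <= j)%N -> T x j 0 = 0 &
        forall j : 'I_d, (a < j < m)%N -> T v j 0 = 0].
  have [G' [T [h1 h2 h3 h4 h5]]] := step d (leqnn d).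
  by exists G', T; split => // j aj; apply: h5; rewrite aj ltn_ord.
elim: m => [_|m IH md].
  by exists G, id; split => // j; rewrite ltn0 andbF.
have [G1 [T1 [h1 h2 h3 h4 h5]]] := IH (ltnW md).
have [ma|am] := leqP m a.
  exists G1, T1; split => // j /andP[aj]; rewrite ltnS => jm.
  by have := leq_trans aj (leq_trans jm ma); rewrite ltnn.
pose b := Ordinal md.
have ab : a != b by rewrite -val_eqE/= neq_ltn am.
pose x0 := T1 v a 0; pose y0 := T1 v b 0.
pose r := Num.sqrt (x0 ^+ 2 + y0 ^+ 2).
have r2 : r ^+ 2 = x0 ^+ 2 + y0 ^+ 2 by rewrite sqr_sqrtr// addr_ge0 ?sqr_ge0.
have jm1 j : (a < j < m.+1)%N = (a < j < m)%N || (j == m).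
  rewrite ltnS (leq_eqVlt j) andb_orr orbC; congr (_ || _).
  by case: eqP => [->|_]; rewrite ?am ?andbF.
have [r0|r0] := eqVneq r 0.
  exists G1, T1; split => // j; rewrite jm1 => /orP[/h5//|/eqP jm].
  have -> : j = b by exact/val_inj.
  move: r2; rewrite r0 expr0n => /esym/eqP.
  by rewrite paddr_eq0 ?sqr_ge0// !sqrf_eq0 => /andP[_ /eqP].
have cs : (x0 / r) ^+ 2 + (y0 / r) ^+ 2 = 1.
  by rewrite !expr_div_n -mulrDl -r2 divff// expf_neq0.
have [G2 G2_iid G2E] := column_reflection ab cs h1.
exists G2, (reflect_coord a b (x0 / r) (y0 / r) \o T1); split => //.
- by move=> w x; rewrite h2 G2E.
- by move=> x y; rewrite -[RHS]h3 !dotE reflect_coord_pairing.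
- move=> x x0' j aj; have := h4 x x0' => T0.
  rewrite /= !mxE (T0 a)// (T0 b (ltnW am)) !mulr0 subr0 addr0 (T0 j)//.
  by case: ifP => // _; case: ifP.
- move=> j; rewrite jm1 => /orP[jm|/eqP jm].
    have ja : (j == a) = false by apply/negbTE; rewrite -val_eqE/= neq_ltn;
      case/andP: jm => -> _; rewrite orbT.
    have jb : (j == b) = false by apply/negbTE; rewrite -val_eqE/= neq_ltn;
      case/andP: jm => _ ->.
    by rewrite /= !mxE ja jb h5.
  have -> : j = b by exact/val_inj.
  rewrite /= !mxE (negbTE (_ : b != a)) 1?eq_sym// eqxx -/x0 -/y0.
  by rewrite mulrAC [x0 / r * y0]mulrAC [y0 * x0]mulrC subrr.
Qed.

End column_reflection.

Section normal_combination.
Context {dQ : measure_display} {Q : measurableType dQ} {R : realType}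
  {PQ : probability Q R}.
Variables (sigma : R).
Hypothesis sigma0 : 0 < sigma.
Local Notation gauss := (normal_prob 0 sigma).

(* A one-row instance of triangularize. *)
Lemma normal_combination k (Y : 'I_k.+1 -> {RV PQ >-> R}) (x : 'I_k.+1 -> R) :
  iid Y gauss ->
  exists (Z : {RV PQ >-> R}) (r : R),
    [/\ forall A, measurable A -> PQ (Z @^-1` A) = gauss A,
        r ^+ 2 = \sum_i x i ^+ 2 &
        forall w, \sum_i x i * Y i w = r * Z w].
Proof.
move=> Y_iid.
pose G (p : 'I_1 * 'I_k.+1) := Y p.2.
have G_iid : iid G gauss.
  have inj : injective (fun p : 'I_1 * 'I_k.+1 => p.2).
    by move=> [i j] [i' j'] /= ->; rewrite (ord1 i) (ord1 i').
  exact: (iid_inj inj Y_iid).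
have [G' [T [G'_iid GT Tdot _ T0]]] := triangularize sigma0 ord0 (\col_i x i) G_iid.
pose r := T (\col_i x i) ord0 0.
have only0 (F : 'I_k.+1 -> R) :
    \sum_j F j * T (\col_i x i) j 0 = F ord0 * r.
  rewrite big_ord_recl /= -/r big1 ?addr0// => j _.
  by rewrite T0 ?mulr0// lift0.
exists (G' (ord0, ord0)), r; split.
- by move=> A mA; have [_ law] := G'_iid; exact: law.
- have := Tdot (\col_i x i) (\col_i x i); rewrite !dotE only0 -/r -expr2 => ->.
  by apply: eq_bigr => i _; rewrite mxE expr2.
- move=> w; have := GT w (\col_i x i) => /colP/(_ ord0); rewrite !mxE.
  under eq_bigr do rewrite !mxE mulrC.
  move=> ->; under eq_bigr do rewrite mxE.
  by rewrite only0 mulrC.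
Qed.

End normal_combination.

(** * The flipping probability *)

Section tuple_laws.
Context {dT : measure_display} {T : measurableType dT} {R : realType}.

Definition box n (A : 'I_n -> set T) : set (n.-tuple T) :=
  \bigcap_i (fun t => tnth t i) @^-1` A i.

Lemma measurable_box n (A : 'I_n -> set T) :
  (forall i, measurable (A i)) -> measurable (box A).
Proof.
move=> mA; apply: fin_bigcap_measurable => // i _.
by rewrite -[X in measurable X]setTI; apply: measurable_tnth.
Qed.

(** Boxes are stable under intersection and generate the product sigma-algebra. *)
Lemma tuple_measure_unique n (m1 m2 : {measure set (n.-tuple T) -> \bar R}) :
  (m1 [set: n.-tuple T] < +oo)%E ->
  (forall A : 'I_n -> set T, (forall i, measurable (A i)) -> m1 (box A) = m2 (box A)) ->
  forall E, measurable E -> m1 E = m2 E.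
Proof.
move=> fin1 m12 E mE.
pose boxes := [set B | exists2 A : 'I_n -> set T, (forall i, measurable (A i)) & B =
  box A].
have boxT : boxes setT.
  by exists (fun=> setT) => //; apply/seteqP; split.
apply: (measure_unique boxes (fun=> setT)) => //.
- apply/seteqP; split.
    apply: smallest_sub; first exact: smallest_sigma_algebra.
    move=> B; rewrite -bigcup_seq => -[i _ [C mC <-]].
    apply: sub_sigma_algebra; exists (fun j => if j == i then C else setT).
      by move=> j; case: ifP.
    apply/seteqP; split => [t [_ Ct] j _|t h].
      by rewrite /=; case: eqP => // ->.
    by split => //; have := h i Logic.I; rewrite /= eqxx.
  apply: smallest_sub; first exact: sigma_algebra_measurable.
  by move=> B [A mA ->]; exact: measurable_box.
- move=> _ _ [A mA ->] [B mB ->]; exists (fun i => A i `&` B i).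
    by move=> i; exact: measurableI.
  by rewrite /box -bigcapI.
- by rewrite bigcup_const.
- by move=> B [A mA ->]; exact: m12.
Qed.

End tuple_laws.

Section joint_law.
Context {dO dT : measure_display} {O : measurableType dO}
  {T : measurableType dT} {R : realType} {P : probability O R}.
Context {n : nat} (X Y : 'I_n -> {RV P >-> T}).

Definition rv_tuple (Z : 'I_n -> {RV P >-> T}) (w : O) : n.-tuple T :=
  [tuple Z i w | i < n].

Lemma measurable_rv_tuple Z : measurable_fun [set: O] (rv_tuple Z).
Proof.
apply/measurable_fun_tnthP => i.
by rewrite (_ : _ \o _ = Z i)//; apply/funext => w; rewrite /= tnth_mktuple.
Qed.

Lemma rv_tuple_box Z A : rv_tuple Z @^-1` box A = \bigcap_i Z i @^-1` A i.
Proof.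
by apply/seteqP; split => w h i _; have := h i Logic.I; rewrite /= tnth_mktuple.
Qed.

Hypothesis indep : forall A B : 'I_n -> set T,
  (forall i, measurable (A i)) -> (forall i, measurable (B i)) ->
  P ((\bigcap_i X i @^-1` A i) `&` (\bigcap_i Y i @^-1` B i)) =
  (P (\bigcap_i X i @^-1` A i) * P (\bigcap_i Y i @^-1` B i))%E.

Lemma rv_tuple_indep (E F : set (n.-tuple T)) : measurable E -> measurable F ->
  P ((rv_tuple X @^-1` E) `&` (rv_tuple Y @^-1` F)) =
  (P (rv_tuple X @^-1` E) * P (rv_tuple Y @^-1` F))%E.
Proof.
move=> mE mF.
have mpre Z (A : set (n.-tuple T)) : measurable A -> measurable (rv_tuple Z @^-1` A).
  by move=> mA; rewrite -[X in measurable X]setTI; exact: measurable_rv_tuple.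
have fin (A : set O) : measurable A -> exists2 r : {nonneg R}, P A = r%:num%:E & True.
  move=> mA; exists (NngNum (fine_ge0 (measure_ge0 P A))) => //=.
  by rewrite fineK// fin_num_measure.
(* pi-lambda in one tuple, the event on the other one being fixed. *)
have fixed (Z : 'I_n -> {RV P >-> T}) (C : set O) : measurable C ->
    (forall A : 'I_n -> set T, (forall i, measurable (A i)) ->
      P ((\bigcap_i Z i @^-1` A i) `&` C) = (P (\bigcap_i Z i @^-1` A i) * P C)%E) ->
    forall A : set (n.-tuple T), measurable A ->
      P ((rv_tuple Z @^-1` A) `&` C) = (P (rv_tuple Z @^-1` A) * P C)%E.
  move=> mC ZC A mA; have [r rE _] := fin C mC.
  have mZ := measurable_rv_tuple Z.
  have [m1 m1E] : exists m : {measure set (n.-tuple T) -> \bar R},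
      forall B, m B = P ((rv_tuple Z @^-1` B) `&` C).
    unshelve refine (ex_intro _
      (pushforward (mrestr P mC) (rv_tuple Z) : {measure set _ -> \bar R}) _).
      exact: mZ.
    by [].
  have [m2 m2E] : exists m : {measure set (n.-tuple T) -> \bar R},
      forall B, m B = (r%:num%:E * P (rv_tuple Z @^-1` B))%E.
    unshelve refine (ex_intro _
      (mscale r (pushforward P (rv_tuple Z)) : {measure set _ -> \bar R}) _).
      exact: mZ.
    by [].
  rewrite -m1E rE muleC -m2E; apply: tuple_measure_unique => //.
    rewrite m1E -ge0_fin_numE// fin_num_measure//.
    by apply: measurableI => //; exact: mpre.
  move=> B mB; rewrite m1E m2E rv_tuple_box ZC// rE muleC//.
apply: (fixed X) => //; first exact: mpre.
move=> A mA; rewrite [X in P X = _]setIC [RHS]muleC.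
have mXA : measurable (\bigcap_i X i @^-1` A i).
  by apply: fin_bigcap_measurable => // i _; rewrite -[X in measurable X]setTI;
    exact: measurable_funP.
refine (fixed Y _ mXA _ F mF) => B mB.
by rewrite [X in P X = _]setIC [RHS]muleC indep.
Qed.

End joint_law.

Section half_line.
Context {R : realType} (sigma : R).
Hypothesis sigma0 : 0 < sigma.
Local Notation gauss := (normal_prob 0 sigma).

Lemma measurable_half_line (p q : R) : measurable [set y : R | p + q * y <= 0].
Proof.
rewrite -[X in measurable X]setTI.
have mf : measurable_fun [set: R] (fun y : R => p + q * y).
  by apply: measurable_funD => //; exact: measurable_funM.
exact: (@measurable_fun_ler _ _ _ _ _ (cst 0) mf _ _ [set true]).
Qed.

Lemma normal_prob_half_line (p q : R) : q != 0 ->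
  gauss [set y | p + q * y <= 0] = gauss `]-oo, (- (p / `|q|))%R].
Proof.
move=> q0; have [qp|qn] := ltP 0 q.
  congr (gauss _); apply/seteqP; split => y /=; rewrite in_itv/= gtr0_norm//;
    by rewrite -mulNr ler_pdivlMr// -lerBrDl sub0r mulrC.
have {}qn : q < 0 by rewrite lt_neqAle q0.
rewrite -[RHS]normal_probN//; congr (gauss _); apply/seteqP.
by split => y /=; rewrite in_itv/= ltr0_norm// invrN mulrN opprK;
  rewrite ler_ndivlMr// mulNr -[p <= _]subr_le0 opprK [y * q]mulrC.
Qed.

(** For [q = 0] the quotient is [0] by convention, and the hypothesis makes the half line
    everything. *)
Lemma normal_prob_half_line_ge (p q : R) : (q = 0 -> p <= 0) ->
  1 <= 2 * fine (gauss [set y | p + q * y <= 0]) +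
       normal_peak sigma * (2 * Num.max 0 (p / `|q|)).
Proof.
move=> pq; have [q0|q0] := eqVneq q 0.
  have -> : [set y | p + q * y <= 0] = setT.
    by apply/seteqP; split => // y _ /=; rewrite q0 mul0r addr0 pq.
  rewrite (_ : gauss setT = 1%E); last exact: probability_setT.
  have h : 0 <= normal_peak sigma * (2 * Num.max 0 (p / `|q|)).
    by rewrite !mulr_ge0 ?normal_peak_ge0// le_max lexx.
  by rewrite /=; lra.
by rewrite normal_prob_half_line// normal_prob_tail.
Qed.

End half_line.

Section gaussian_sign.
Context {dQ : measure_display} {Q : measurableType dQ} {R : realType}
  {PQ : probability Q R}.
Variables (sigma : R).
Hypothesis sigma0 : 0 < sigma.
Local Notation gauss := (normal_prob 0 sigma).

Lemma columns_indep k d (G : 'I_k * 'I_d -> {RV PQ >-> R}) (a b : 'I_d)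
    (A B : 'I_k -> set R) : a != b -> iid G gauss ->
  (forall i, measurable (A i)) -> (forall i, measurable (B i)) ->
  PQ ((\bigcap_i G (i, a) @^-1` A i) `&` (\bigcap_i G (i, b) @^-1` B i)) =
  (PQ (\bigcap_i G (i, a) @^-1` A i) * PQ (\bigcap_i G (i, b) @^-1` B i))%E.
Proof.
move=> ab G_iid mA mB; have ba : b != a by rewrite eq_sym.
have gT : gauss [set: R] = 1%E by exact: probability_setT.
have box := (iid_boxP G gT).1 G_iid.
have injc (c : 'I_d) : injective (fun i : 'I_k => (i, c)) by move=> i j [].
have -> : PQ (\bigcap_i G (i, a) @^-1` A i) = (\prod_i gauss (A i))%E.
  exact: ((iid_boxP _ gT).1 (iid_inj (injc a) G_iid) A mA).
have -> : PQ (\bigcap_i G (i, b) @^-1` B i) = (\prod_i gauss (B i))%E.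
  exact: ((iid_boxP _ gT).1 (iid_inj (injc b) G_iid) B mB).
pose C (u : 'I_k * 'I_d) := if u.2 == a then A u.1 else if u.2 == b then B u.1 else
  setT.
have mC u : measurable (C u) by rewrite /C; case: ifP => // _; case: ifP.
have -> : (\bigcap_i G (i, a) @^-1` A i) `&` (\bigcap_i G (i, b) @^-1` B i) =
    \bigcap_u G u @^-1` C u.
  apply/seteqP; split => w.
    move=> [hA hB] [i j] _; rewrite /C /=.
    by case: eqP => [->|_]; [exact: hA|case: eqP => [->|//]; exact: hB].
  move=> h; split => i _.
    by have := h (i, a) Logic.I; rewrite /C /= eqxx.
  by have := h (i, b) Logic.I; rewrite /C /= (negbTE ba) eqxx.
rewrite box// -big_split/= -(pair_bigA _ (fun i j => gauss (C (i, j))))/=.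
apply: eq_bigr => i _; rewrite (bigD1 a)//= (bigD1 b)//= /C /= eqxx (negbTE ba) eqxx.
rewrite big1 ?mule1// => j /andP[/negbTE ja /negbTE jb].
by rewrite ja jb; exact: gT.
Qed.

(** For a fixed value [x] of [X], the sum of the [x i * Y i] is [r] times a Gaussian, with [r] the
    norm of [x] up to sign, and the event is a half line whose threshold is proportional to that
    norm. Integrating over [x] leaves the mean norm of [X]. *)
Lemma gaussian_sign_bound k (X Y : 'I_k.+1 -> {RV PQ >-> R}) (p0 q0 : R) :
  (forall A B : 'I_k.+1 -> set R,
    (forall i, measurable (A i)) -> (forall i, measurable (B i)) ->
    PQ ((\bigcap_i X i @^-1` A i) `&` (\bigcap_i Y i @^-1` B i)) =
    (PQ (\bigcap_i X i @^-1` A i) * PQ (\bigcap_i Y i @^-1` B i))%E) ->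
  iid X gauss -> iid Y gauss -> q0 != 0 ->
  1 <= 2 * fine (PQ [set w | p0 * (\sum_i X i w ^+ 2) +
                             q0 * (\sum_i X i w * Y i w) <= 0]) +
       Num.sqrt (2 * k.+1%:R / pi) * (Num.max 0 p0 / `|q0|).
Proof.
move=> XY X_iid Y_iid q00.
pose tX : {RV PQ >-> (k.+1.-tuple R)} := rv_of (measurable_rv_tuple X).
pose tY : {RV PQ >-> (k.+1.-tuple R)} := rv_of (measurable_rv_tuple Y).
pose E : set (k.+1.-tuple R * k.+1.-tuple R) :=
  [set z | p0 * (\sum_i tnth z.1 i ^+ 2) + q0 * (\sum_i tnth z.1 i * tnth z.2 i) <= 0].
have mE : measurable E.
  have m1 i : measurable_fun [set: k.+1.-tuple R * k.+1.-tuple R] (fun z => tnth z.1 i).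
    exact: (measurableT_comp (measurable_tnth i) measurable_fst).
  have m2 i : measurable_fun [set: k.+1.-tuple R * k.+1.-tuple R] (fun z => tnth z.2 i).
    exact: (measurableT_comp (measurable_tnth i) measurable_snd).
  have mq : measurable_fun [set: k.+1.-tuple R * k.+1.-tuple R] (fun z =>
      p0 * (\sum_i tnth z.1 i ^+ 2) + q0 * (\sum_i tnth z.1 i * tnth z.2 i)).
    apply: measurable_funD; apply: measurable_funM => //; apply: measurable_sum => i.
      exact: measurable_funX.
    exact: measurable_funM.
  rewrite -[X in measurable X]setTI.
  exact: (@measurable_fun_ler _ _ _ _ _ (cst 0) mq _ _ [set true]).
have mpair : measurable_fun [set: Q] (fun w => (tX w, tY w)).
  exact: measurable_fun_pair.
pose tXY : {RV PQ >-> (k.+1.-tuple R * k.+1.-tuple R)%type} := rv_of mpair.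
have tXE w i : tnth (tX w) i = X i w by rewrite /tX/= tnth_mktuple.
have tYE w i : tnth (tY w) i = Y i w by rewrite /tY/= tnth_mktuple.
have EE w : p0 * (\sum_i tnth (tX w) i ^+ 2) + q0 * (\sum_i tnth (tX w) i * tnth (tY w)
  i)
    = p0 * (\sum_i X i w ^+ 2) + q0 * (\sum_i X i w * Y i w).
  by congr (_ * _ + _ * _); apply: eq_bigr => i _; rewrite tXE ?tYE.
pose f := PQ [set w | p0 * (\sum_i X i w ^+ 2) + q0 * (\sum_i X i w * Y i w) <= 0].
have fE : f = (\int[distribution PQ tX]_x distribution PQ tY (xsection E x))%E.
  transitivity (distribution PQ tXY E).
    rewrite /distribution /pushforward /f; congr (PQ _).
    by apply/seteqP; split => w; rewrite /preimage /= /E /= EE.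
  apply/esym/product_measure_unique => // A B mA mB.
  exact: (rv_tuple_indep XY mA mB).
pose m := Num.max 0 p0.
pose C := normal_peak sigma * (2 * (m / `|q0|)).
have C0 : 0 <= C by rewrite !mulr_ge0 ?normal_peak_ge0 ?invr_ge0// le_max lexx.
pose S (x : k.+1.-tuple R) := \sum_i tnth x i ^+ 2.
have S0 x : 0 <= S x by apply: sumr_ge0 => i _; exact: sqr_ge0.
have cond (x : k.+1.-tuple R) : (1 <= 2%:E * distribution PQ tY (xsection E x) +
    (C * Num.sqrt (S x))%:E)%E.
  have [Z [r [Zlaw r2 ZE]]] := normal_combination sigma0 (tnth x) Y_iid.
  have -> : distribution PQ tY (xsection E x) = gauss [set y | p0 * r ^+ 2 + q0 * r * y
    <= 0].
    rewrite -Zlaw; last exact: measurable_half_line.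
    rewrite /distribution /pushforward; congr (PQ _).
    have e w : p0 * r ^+ 2 + q0 * r * Z w = p0 * S x + q0 * (\sum_i tnth x i * tnth (tY
      w) i).
      by rewrite r2 -mulrA -ZE; congr (_ + _ * _); apply: eq_bigr => i _; rewrite tYE.
    by apply/seteqP; split => w; rewrite /preimage /= /xsection /= inE /E /= e.
  have rp : q0 * r = 0 -> p0 * r ^+ 2 <= 0.
    by move=> /eqP; rewrite mulf_eq0 (negbTE q00)/= => /eqP ->; rewrite expr0n mulr0.
  have := normal_prob_half_line_ge sigma0 rp.
  have -> : Num.sqrt (S x) = `|r| by rewrite /S -r2 sqrtr_sqr.
  have -> : normal_peak sigma * (2 * Num.max 0 (p0 * r ^+ 2 / `|q0 * r|)) = C * `|r|.
    rewrite /C -!mulrA; congr (_ * (_ * _)).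
    rewrite /m maxr_pMl ?mulr_ge0 ?invr_ge0// mul0r; congr (Num.max _ _).
    have [->|r0] := eqVneq r 0; first by rewrite normr0 !(mul0r, mulr0).
    have rr : r * r = `|r| * `|r| by rewrite -!expr2 real_normK ?num_real.
    rewrite normrM [r * (r / _)]mulrA rr.
    by field; rewrite !normr_eq0 r0 q00.
  rewrite -lee_fin EFinD EFinM fineK//; apply: (fin_num_measure gauss).
  exact: measurable_half_line.
(* The root of the bound on the mean of [S]. AM-GM with weight [u] replaces Jensen for the square
   root, so that second moments suffice; both of its halves then contribute [C * u / 2]. *)
pose u := sigma * Num.sqrt k.+1%:R.
have u0 : 0 < u by rewrite mulr_gt0// sqrtr_gt0.
have amgm (x : k.+1.-tuple R) : C * Num.sqrt (S x) <= C / (2 * u) * S x + C * u / 2.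
  have -> : C / (2 * u) * S x + C * u / 2 = C * ((S x / u + u) / 2).
    by field; rewrite gt_eqF.
  rewrite ler_wpM2l// ler_pdivlMr// -(ler_pM2r u0).
  have -> : (S x / u + u) * u = S x + u ^+ 2 by field; rewrite gt_eqF.
  have := sqr_sqrtr (S0 x); have := sqr_ge0 (Num.sqrt (S x) - u).
  by rewrite !expr2; lra.
have mS : measurable_fun [set: k.+1.-tuple R] S.
  by apply: measurable_sum => i; apply: measurable_funX; exact: measurable_tnth.
have mF : measurable_fun [set: k.+1.-tuple R]
    (fun x => distribution PQ tY (xsection E x)).
  exact: measurable_fun_xsection.
have second i : (\int[PQ]_w (X i w ^+ 2)%:E <= (sigma ^+ 2)%:E)%E.
  apply: le_trans (normal_second_moment sigma0); rewrite le_eqVlt; apply/orP; left;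
    apply/eqP.
  pose XT : Q -> measurableTypeR R := X i.
  have mXT : measurable_fun [set: Q] XT by exact: (measurable_funP (X i)).
  have msq : measurable_fun [set: measurableTypeR R] (fun x : measurableTypeR R => ((x
    : R) ^+ 2)%:E).
    by apply/measurable_EFinP; exact: measurable_funX.
  transitivity (\int[pushforward PQ XT]_x ((x : R) ^+ 2)%:E)%E.
    by rewrite (ge0_integral_pushforward mXT)// => y _; rewrite lee_fin sqr_ge0.
  have [_ law] := X_iid.
  have [mu muE] : exists mu : {measure set (measurableTypeR R) -> \bar R},
      mu = pushforward PQ XT :> (_ -> _).
    by unshelve refine (ex_intro _ (pushforward PQ XT : {measure set _ -> \bar R}) _).
  rewrite -muE; apply: eq_measure_integral => A mA _.
  by rewrite muE; exact: law.
have SX : (\int[distribution PQ tX]_x (S x)%:E <= (k.+1%:R * sigma ^+ 2)%:E)%E.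
  rewrite ge0_integral_distribution//; last by apply/measurable_EFinP.
  rewrite (_ : (\int[PQ]_w _)%E = (\sum_i \int[PQ]_w (X i w ^+ 2)%:E)%E).
    have -> : (k.+1%:R * sigma ^+ 2)%:E = (\sum_(i < k.+1) (sigma ^+ 2)%:E)%E.
      by rewrite sumEFin sumr_const card_ord mulr_natl.
    by apply: lee_sum => i _; exact: second.
  rewrite -ge0_integral_sum//.
  - apply: eq_integral => w _; rewrite /= /S -sumEFin.
    by apply: eq_bigr => i _; rewrite -tXE.
  - by move=> i; apply/measurable_EFinP; exact: measurable_funX.
  - by move=> i w _; rewrite lee_fin sqr_ge0.
have final : (1 <= 2%:E * f + (C / (2 * u))%:E * \int[distribution PQ tX]_x (S x)%:E
    + (C * u / 2)%:E)%E.
  have K1 : 0 <= C / (2 * u) by rewrite divr_ge0// mulr_ge0// ltW.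
  have K0 : 0 <= C * u / 2 by rewrite divr_ge0// mulr_ge0// ltW.
  have mSE : measurable_fun [set: k.+1.-tuple R] (fun x => (S x)%:E).
    exact/measurable_EFinP.
  have int1 : (\int[distribution PQ tX]_(x in setT) cst (C * u / 2)%:E x = (C * u /
    2)%:E)%E.
    rewrite integral_cst// [X in (_ * X)%E](_ : _ = 1%E) ?mule1//.
    exact: probability_setT.
  have int2 : (\int[distribution PQ tX]_(x in setT) cst 1%E x = 1)%E.
    rewrite integral_cst// mul1e; exact: probability_setT.
  have E0 x : (0 <= 2%:E * distribution PQ tY (xsection E x))%E by exact: mule_ge0.
  have S0' x : (0 <= (C / (2 * u))%:E * (S x)%:E)%E by rewrite -EFinM lee_fin mulr_ge0.
  have mF2 : measurable_fun [set: k.+1.-tuple R]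
      (fun x => 2%:E * distribution PQ tY (xsection E x))%E by exact: emeasurable_funM.
  have mS2 : measurable_fun [set: k.+1.-tuple R]
      (fun x => (C / (2 * u))%:E * (S x)%:E)%E by exact: emeasurable_funM.
  rewrite fE -ge0_integralZl// -[X in (_ + X * _ + _)%E]/((C / (2 * u))%:E).
  rewrite -ge0_integralZl//; last by move=> x _; rewrite lee_fin.
  rewrite -int1 -ge0_integralD// -ge0_integralD//; last 2 first.
  - by move=> x _; exact: adde_ge0.
  - exact: emeasurable_funD.
  rewrite -[leLHS]int2; apply: ge0_le_integral => //.
  - by apply: emeasurable_funD => //; exact: emeasurable_funD.
  - move=> x _; apply: (le_trans (cond x)); rewrite -addeA leeD2l//.
    by rewrite -EFinM -EFinD lee_fin amgm.
have ffin : f \is a fin_num.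
  apply: fin_num_measure.
  rewrite (_ : [set w | _] = tXY @^-1` E).
    by rewrite -[X in measurable X]setTI; exact: (measurable_funP tXY).
  by apply/seteqP; split => w; rewrite /preimage /= /E /= EE.
have : (1 <= 2%:E * f + (C * u)%:E)%E.
  apply: (le_trans final); rewrite -addeA leeD2l//.
  apply: (@le_trans _ _ ((C / (2 * u))%:E * (k.+1%:R * sigma ^+ 2)%:E + (C * u /
    2)%:E)%E).
    by rewrite leeD2r// lee_wpmul2l// lee_fin divr_ge0// mulr_ge0// ltW.
  rewrite -EFinM -EFinD lee_fin.
  have -> : k.+1%:R * sigma ^+ 2 = u ^+ 2 by rewrite /u exprMn sqr_sqrtr// mulrC.
  by rewrite le_eqVlt; apply/orP; left; apply/eqP; field; rewrite gt_eqF.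
rewrite -/f -[f]fineK// -EFinM -EFinD lee_fin.
(* Here [sigma] cancels between the peak of the density and [u]. *)
suff -> : C * u = Num.sqrt (2 * k.+1%:R / pi) * (m / `|q0|) by [].
rewrite /C /u normal_peakE//.
have pi0 : 0 < pi :> R by exact: pi_gt0.
have -> : Num.sqrt (pi *+ 2) = Num.sqrt 2 * Num.sqrt pi :> R.
  by rewrite -[pi *+ 2]mulr_natl sqrtrM.
rewrite sqrtrM ?mulr_ge0// sqrtrM// sqrtrV ?ltW//.
have s2 : Num.sqrt 2 * Num.sqrt 2 = 2 :> R by rewrite -expr2 sqr_sqrtr.
have s20 : Num.sqrt 2 != 0 :> R by rewrite gt_eqF// sqrtr_gt0.
have sp0 : Num.sqrt pi != 0 :> R by rewrite gt_eqF// sqrtr_gt0.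
rewrite -[X in _ * (X * _) * _]s2; field.
by rewrite s20 sp0 normr_eq0 q00 gt_eqF.
Qed.

End gaussian_sign.

Section flip_bound.
Context {dQ : measure_display} {Q : measurableType dQ} {R : realType}
  {PQ : probability Q R}.

(* In coordinates adapted to h and u, R h is a multiple of a standard Gaussian
   vector X, and R u is a combination of X and of an independent copy Y. *)
Lemma flip_decomposition k d (sigma : R) (G : 'I_k * 'I_d -> {RV PQ >-> R})
    (h u : 'cV[R]_d) : 0 < sigma -> iid G (normal_prob 0 sigma) -> h != 0 ->
  exists (X Y : 'I_k -> {RV PQ >-> R}) (p q : R),
  [/\ forall w, dot (matrix_of G w *m h) (matrix_of G w *m u) =
        p * (\sum_i X i w ^+ 2) + q * (\sum_i X i w * Y i w),
      p = dot h u, p ^+ 2 + q ^+ 2 = dot h h * dot u u &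
      q != 0 -> [/\ iid X (normal_prob 0 sigma), iid Y (normal_prob 0 sigma) &
        forall A B : 'I_k -> set R,
          (forall i, measurable (A i)) -> (forall i, measurable (B i)) ->
          PQ ((\bigcap_i X i @^-1` A i) `&` (\bigcap_i Y i @^-1` B i)) =
          (PQ (\bigcap_i X i @^-1` A i) * PQ (\bigcap_i Y i @^-1` B i))%E]].
Proof.
move=> sigma0 G_iid h0; case: d G h u G_iid h0 => [|[|d]] G h u G_iid h0.
- by move: h0; rewrite (_ : h = 0) ?eqxx//; apply/colP => -[].
- exists (fun i => G (i, ord0)), (fun i => G (i, ord0)), (h ord0 0 * u ord0 0), 0.
  split; rewrite ?eqxx//.
  + move=> w; rewrite mul0r addr0 dotE mulr_sumr; apply: eq_bigr => i _.
    by rewrite !mxE !big_ord1 !mxE; ring.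
  + by rewrite dotE big_ord1.
  + by rewrite !dotE !big_ord1; ring.
have [G1 [T1 [G1_iid G1E T1dot _ T1h]]] := triangularize sigma0 ord0 h G_iid.
pose o1 : 'I_d.+2 := lift ord0 ord0.
(* The second elimination starts at coordinate [1], from which on [T1 h] vanishes: [h] keeps its
   single coordinate and [u] is left with two. *)
have [G2 [T2 [G2_iid G2E T2dot T2low T2u]]] := triangularize sigma0 o1 (T1 u) G1_iid.
pose h' := T2 (T1 h); pose u' := T2 (T1 u).
have h'0 j : h' (lift ord0 j) 0 = 0.
  by apply: T2low => // i; rewrite /o1 /= => i1; apply: T1h.
have u'0 j : u' (lift ord0 (lift ord0 j)) 0 = 0 by apply: T2u.
have sumh (F : 'I_d.+2 -> R) : \sum_j F j * h' j 0 = F ord0 * h' ord0 0.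
  by rewrite big_ord_recl big1 ?addr0// => j _; rewrite h'0 mulr0.
have sumu (F : 'I_d.+2 -> R) : \sum_j F j * u' j 0 = F ord0 * u' ord0 0 + F o1 * u' o1
  0.
  rewrite big_ord_recl big_ord_recl big1 ?addr0// => j _.
  by rewrite u'0 mulr0.
exists (fun i => G2 (i, ord0)), (fun i => G2 (i, o1)),
  (h' ord0 0 * u' ord0 0), (h' ord0 0 * u' o1 0).
split.
- move=> w; rewrite !G1E !G2E -/h' -/u' dotE !mulr_sumr -big_split/=.
  apply: eq_bigr => i _; rewrite !mxE sumh sumu !mxE; ring.
- by rewrite -T1dot -T2dot -/h' -/u' dotC dotE sumh mulrC.
- rewrite -(T1dot h) -(T2dot (T1 h)) -(T1dot u) -(T2dot (T1 u)) -/h' -/u'.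
  by rewrite !dotE sumh sumu; ring.
- have injc (c : 'I_d.+2) : injective (fun i : 'I_k => (i, c)) by move=> i j [].
  move=> _; split; [exact: (iid_inj (injc _) G2_iid)|exact: (iid_inj (injc _) G2_iid)|].
  by move=> A B mA mB; exact: (columns_indep _ G2_iid).
Qed.

(** The bound from [gaussian_sign_bound] involves a cotangent, which is not Lipschitz in the cosine
    [c]. Only [0 < L * c < 1] is critical, and there the sine satisfies [s ^+ 2 > 1 - 1 / L ^+ 2 = a
    ^+ 2 / L ^+ 2] with [a ^+ 2 = 2 k / pi], so that [a] over the absolute value of [s] is at most
    [L]. This dictates [L ^+ 2 = 1 + a ^+ 2]. *)
Lemma flip_prob_lower_bound {k d : nat} (G : 'I_k * 'I_d -> {RV PQ >-> R})
  (h u : 'cV[R]_d) : (0 < k)%N -> gaussian_matrix G -> h != 0 -> u != 0 ->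
  Num.min 1 (1 - Num.sqrt (1 + 2 * k%:R / pi) * dot (normalize h) (normalize u)) <=
  2 * flip_prob G h u.
Proof.
case: k G => // k G _ [sigma sigma0 G_iid] h0 u0.
have [X [Y [p [q [decomp pE pq indep]]]]] := flip_decomposition u sigma0 G_iid h0.
have f0 := flip_prob_ge0 G h u.
have nh : 0 < enorm h by rewrite lt0r enorm_eq0 h0 enorm_ge0.
have nu : 0 < enorm u by rewrite lt0r enorm_eq0 u0 enorm_ge0.
pose n := enorm h * enorm u.
have n0 : 0 < n by rewrite mulr_gt0.
have -> : dot (normalize h) (normalize u) = p / n.
  by rewrite pE dotZl dotZr /n; field; rewrite !gt_eqF.
have pqn : p * p + q * q = n * n.
  by rewrite -!expr2 pq /n exprMn !sqr_enorm.
have flipE : flip_prob G h u = fine (PQ [set w | p * (\sum_i X i w ^+ 2) +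
    q * (\sum_i X i w * Y i w) <= 0]).
  by rewrite /flip_prob; congr (fine (PQ _)); apply/seteqP; split => w /=;
    rewrite decomp.
set a2 : R := 2 * k.+1%:R / pi; set L := Num.sqrt (1 + a2).
have a20 : 0 <= a2 by rewrite divr_ge0 ?mulr_ge0// pi_ge0.
have LL : L * L = 1 + a2 by rewrite -expr2 sqr_sqrtr// addr_ge0.
have L0 : 0 <= L by exact: sqrtr_ge0.
rewrite ge_min; have [p0|p0] := leP p 0.
  apply/orP; left; have [q0|q0] := eqVneq q 0.
    rewrite flipE (_ : [set w | _] = setT) ?probability_setT ?mulr1 ?ler1n//.
    apply/seteqP; split => // w _ /=; rewrite q0 mul0r addr0 mulr_le0_ge0//.
    by apply: sumr_ge0 => i _; exact: sqr_ge0.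
  have [X_iid Y_iid XY] := indep q0.
  have := gaussian_sign_bound sigma0 p XY X_iid Y_iid q0.
  by rewrite -flipE (max_idPl p0) mul0r mulr0 addr0.
apply/orP; right.
have [Lc|Lc] := leP 1 (L * (p / n)); first by lra.
have Lp : L * p < n by move: Lc; rewrite mulrA ltr_pdivrMr// mul1r.
(* With [p > 0], [q = 0] would mean cosine [1], against [L * p < n] and [L >= 1]. *)
have q0 : q != 0.
  apply/negP => /eqP q0; move: pqn; rewrite q0 mulr0 addr0 => pn.
  have np : n <= p by apply: le_of_sqr; rewrite ?pn// ltW.
  have L1 : 1 <= L by apply: le_of_sqr => //; rewrite LL; lra.
  have : p <= L * p by rewrite ler_peMl// ltW.
  lra.
have [X_iid Y_iid XY] := indep q0.
have := gaussian_sign_bound sigma0 p XY X_iid Y_iid q0.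
rewrite -flipE (max_idPr (ltW p0)) -/a2; set a := Num.sqrt a2.
have aa : a * a = a2 by rewrite -expr2 sqr_sqrtr.
have qq : `|q| * `|q| = q * q by rewrite -!expr2 real_normK ?num_real.
have key : a * n <= L * `|q|.
  apply: le_of_sqr; first by rewrite mulr_ge0.
  have LpLp : (L * p) * (L * p) <= n * n.
    by rewrite ler_pM ?mulr_ge0 ?(ltW Lp) ?(ltW p0).
  rewrite mulrACA aa [leRHS]mulrACA LL qq.
  rewrite mulrACA LL in LpLp.
  have -> : q * q = n * n - p * p by rewrite -pqn addrC addKr.
  lra.
have nq : 0 < `|q| by rewrite normr_gt0.
have : a * (p / `|q|) <= L * (p / n).
  rewrite !mulrA ler_pdivrMr// mulrAC ler_pdivlMr//.
  by rewrite mulrAC [leRHS]mulrAC ler_pM2r.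
lra.
Qed.

End flip_bound.

(** All terms scale like [1 / sqrt N], so this is [margin_slack] with [a ^+ 2 = 2 k / pi], which is
    at least [1 / 2] because [k >= 1] and [pi < 4]. *)
Lemma margin_constants {R : realType} (k N : nat) (delta : R) :
  (0 < k)%N -> (0 < N)%N -> 0 < delta <= 1 ->
  N%:R^-1 * (2 * Num.sqrt (1 + 2 * k%:R / pi) * Num.sqrt N%:R +
    Num.sqrt (2 * N%:R * ln delta^-1)) + (20 * Num.sqrt N%:R)^-1 <=
  2 * Num.sqrt 2 / Num.sqrt pi * Num.sqrt (k%:R / N%:R) +
  3 * Num.sqrt (ln (2 / delta) / (2 * N%:R)).
Proof.
move=> k0 N0 /andP[d0 d1].
have N0R : (0 : R) < N%:R by rewrite ltr0n.
have pi0 : (0 : R) < pi by exact: pi_gt0.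
have pi4 : pi < 4 :> R by have /andP[_] := pihalf_02 R; lra.
have k1 : (1 : R) <= k%:R by rewrite ler1n.
have k0R : (0 : R) < k%:R by lra.
set s := Num.sqrt N%:R; set x := ln delta^-1.
have s0 : 0 < s by rewrite sqrtr_gt0.
have x0 : 0 <= x by rewrite ln_ge0// invf_ge1.
pose a : R := Num.sqrt (2 * k%:R / pi).
have a0 : 0 <= 2 * k%:R / pi :> R by rewrite divr_ge0 ?mulr_ge0// ltW.
have aE : a ^+ 2 = 2 * k%:R / pi by rewrite sqr_sqrtr.
have a2 : 1 / 2 <= a ^+ 2 by rewrite aE ler_pdivlMr//; lra.
have := margin_slack a2 (sqrtr_ge0 _) (sqrtr_ge0 (1 + 2 * k%:R / pi)) _ x0.
rewrite aE sqr_sqrtr => [/(_ erefl)|]; last by rewrite addr_ge0.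
rewrite -/a; set L := Num.sqrt (1 + _); set y := Num.sqrt (x / 2).
have Ns : N%:R = s * s by rewrite -expr2 sqr_sqrtr// ltW.
have -> : Num.sqrt (2 * N%:R * x) = 2 * s * y.
  rewrite (_ : 2 * N%:R * x = (2 * s) ^+ 2 * (x / 2)).
    by rewrite sqrtrM ?sqr_ge0// sqrtr_sqr ger0_norm// mulr_ge0// ltW.
  by rewrite expr2 Ns; field.
have -> : 2 * Num.sqrt 2 / Num.sqrt pi * Num.sqrt (k%:R / N%:R) = 2 * a / s.
  rewrite /a !sqrtrM ?sqrtrV ?invr_ge0 ?mulr_ge0 ?(ltW k0R) ?(ltW pi0)// -/s.
  by field; rewrite !gt_eqF// sqrtr_gt0.
have -> : ln (2 / delta) = ln 2 + x by rewrite lnM ?posrE ?invr_gt0.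
have -> : Num.sqrt ((ln 2 + x) / (2 * N%:R)) = Num.sqrt ((ln 2 + x) / 2) / s.
  have -> : (ln 2 + x) / (2 * N%:R) = (ln 2 + x) / 2 / N%:R.
    by field; rewrite gt_eqF.
  have l2 := @ln2_ge_half R; rewrite sqrtrM; last by lra.
  by rewrite sqrtrV// ltW.
set w := Num.sqrt ((ln 2 + x) / 2) => h.
have -> : N%:R^-1 * (2 * L * s + 2 * s * y) + (20 * s)^-1 =
    (2 * L + 2 * y + 1 / 20) / s.
  by rewrite Ns; field; rewrite gt_eqF.
have -> : 2 * a / s + 3 * (w / s) = (2 * a + 3 * w) / s.
  by field; rewrite gt_eqF.
by rewrite ler_pM2r ?invr_gt0.
Qed.

Theorem theorem3p1 (R : realType) (d k N : nat)
  (k_gt0 : (0 < k)%N) (k_le_d : (k <= d)%N) (N_gt0 : (0 < N)%N)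
  (X : set (d.-tuple R))
  (D : probability (d.-tuple R * bool)%type R)
  (D_on_X : supported_on X D)
  (dO : measure_display) (O : measurableType dO) (P : probability O R)
  (S : 'I_N -> {RV P >-> (d.-tuple R * bool)%type})
  (S_iid : iid S D)
  (dQ : measure_display) (Q : measurableType dQ) (PQ : probability Q R)
  (G : 'I_k * 'I_d -> {RV PQ >-> R})
  (G_gaussian : gaussian_matrix G)
  (delta : R) (delta_gt0 : 0 < delta) :
  with_probability_at_least P (1 - delta)
    [set w | forall h : 'cV[R]_d,
      generalization_error D h <=
        N%:R^-1 * (\sum_(n < N)
          Num.min 1 (2 * flip_prob G h (signed_point (S n w))))
        + 2 * Num.sqrt 2 / Num.sqrt pi * Num.sqrt (k%:R / N%:R)
        + 3 * Num.sqrt (ln (2 / delta) / (2 * N%:R))].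
Proof.
(* For [delta > 1] the required probability is negative and the empty event will do. *)
have [d1|d1] := ltP 1 delta.
  exists set0; first exact: measurable0.
  by split; [rewrite measure0 lee_fin; lra|].
have d01 : 0 < delta <= 1 by rewrite delta_gt0.
have L0 : 0 < Num.sqrt (1 + 2 * k%:R / pi) :> R.
  by rewrite sqrtr_gt0 ltr_pwDl// divr_ge0 ?mulr_ge0// pi_ge0.
have e0 : 0 < (20 * Num.sqrt N%:R)^-1 :> R.
  by rewrite invr_gt0 mulr_gt0// sqrtr_gt0 ltr0n.
have [E mE [PE Egood]] := uniform_margin_bound N_gt0 S_iid L0 e0 d01.
exists E => //; split => // w /Egood /= good h; apply: (le_trans (good h)).
have := margin_constants k_gt0 N_gt0 d01.
set A := N%:R^-1 * \sum_(n < N) clip _; set B := N%:R^-1 * \sum_(n < N) _ => c.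
suff AB : A <= B by lra.
rewrite ler_wpM2l ?invr_ge0//; apply: ler_sum => n _.
(* A zero normal or point has flipping probability [1], so its summand is [1], the largest value of
   the ramp. *)
have [hu|] := pselect (h = 0 \/ signed_point (S n w) = 0).
  rewrite flip_prob_degenerate// mulr1 (min_idPl _); last by lra.
  by have /andP[] := clip01 (1 - Num.sqrt (1 + 2 * k%:R / pi) *
    dot (normalize h) (normalize (signed_point (S n w)))).
move=> /not_orP[/eqP h0 /eqP u0].
apply: clip_min; first by rewrite mulr_ge0// flip_prob_ge0.
exact: flip_prob_lower_bound.
Qed.
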